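(* Let $k$ be a field of characteristic $p\neq 2$ (with $p=0$ allowed). For any positive integer $m$, $$CP(G_0(m))=U(m).$$
   Context: $X=\{x_i\mid i\ge 1\}$ is a countable set of variables and $k_0\langle X\rangle$ is the free nonunitary associative $k$-algebra on $X$. $[u,v]=uv-vu$. Put $x_1\circ x_2=x_1x_2+x_2x_1$ and, for $n\ge3$, $x_1\circ\cdots\circ x_n=(x_1\circ\cdots\circ x_{n-1})\circ x_n$; for $n=1$ the expression is just $x_1$. A $T$-space of $k_0\langle X\rangle$ is a linear subspace invariant under every algebra endomorphism of $k_0\langle X\rangle$. For a set $A\subseteq k_0\langle X\rangle$, $A^S$ denotes the smallest $T$-space of $k_0\langle X\rangle$ containing $A$. $G_0$ is the infinite dimensional nonunitary Grassmann algebra over $k$: it is generated by elements $e_i$, $i\ge1$, with $e_ie_j=-e_je_i$ and $e_i^2=0$, and it has linear basis all products $e_{i_1}\cdots e_{i_n}$, $n\ge1$, $i_1<\cdots<i_n$. $G_0(m)$ is the (nonunitary) subalgebra of $G_0$ generated by $e_1,\ldots,e_m$. An element $f\in k_0\langle X\rangle$ is an identity of $G_0(m)$ if it lies in the kernel of every homomorphism $k_0\langle X\rangle\to G_0(m)$; $T(G_0(m))$ is the set of all identities. An element $f\in k_0\langle X\rangle$ is a central polynomial of $G_0(m)$ if $f\notin T(G_0(m))$ and the image of $f$ under every homomorphism $k_0\langle X\rangle\to G_0(m)$ lies in the centre of $G_0(m)$. $CP(G_0(m))$ is the $T$-space of $k_0\langle X\rangle$ generated by the central polynomials of $G_0(m)$.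 If $p=0$, $S=\{[x_1,x_2]\}^S$. If $p>2$, for each $n\ge1$ let $w_n=\prod_{j=1}^n[x_{2j-1},x_{2j}]x_{2j-1}^{p-1}x_{2j}^{p-1}$, and $S=\{[x_1,x_2]\}^S+\{w_n\mid n\ge1\}^S$. For each positive integer $m$, $S(m)=S+\{x_1\circ\cdots\circ x_{\frac{m+1}{2}}\}^S$ if $m$ is odd and $S(m)=S$ if $m$ is even. Finally $U(m)=S(m)+T(G_0(m))$. *)

(* Defs.v *)
From HB Require Import structures.
From mathcomp Require Import all_boot all_order all_algebra finmap.
From mathcomp Require Import boolp classical_sets.
From mathcomp Require Import monalg.

Set Implicit Arguments.
Unset Strict Implicit.
Unset Printing Implicit Defensive.

Import GRing.Theory.

Local Open Scope fset_scope.
Local Open Scope classical_set_scope.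
Local Open Scope ring_scope.

Reserved Notation "x ** y" (at level 40, left associativity).

(* ssralg has no nonunitary algebras, hence this structure. *)
HB.mixin Record Lmodule_isNuAlgebra (k : fieldType) A of GRing.Lmodule k A := {
  numul : A -> A -> A;
  numulA : associative numul;
  numulDl : left_distributive numul +%R;
  numulDr : right_distributive numul +%R;
  numulZl : forall (a : k) (x y : A), numul (a *: x) y = a *: numul x y;
  numulZr : forall (a : k) (x y : A), numul x (a *: y) = a *: numul x y
}.

#[short(type="nuAlgType")]
HB.structure Definition NuAlgebra (k : fieldType) :=
  {A of GRing.Lmodule k A & Lmodule_isNuAlgebra k A}.

Notation "x ** y" := (numul x y) : ring_scope.

Section NuAlgebraTheory.
Variable k : fieldType.

Definition nu_morphism (A B : nuAlgType k) (phi : {linear A -> B}) : Prop :=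
  {morph phi : x y / x ** y}.

Definition is_subspace (A : nuAlgType k) (V : set A) : Prop :=
  V 0 /\ forall (a : k) (x y : A), V x -> V y -> V (a *: x + y).

Definition is_nu_subalgebra (A : nuAlgType k) (B : set A) : Prop :=
  is_subspace B /\ forall x y, B x -> B y -> B (x ** y).

Definition nu_center (A : nuAlgType k) (B : set A) : set A :=
  [set z | B z /\ forall x, B x -> z ** x = x ** z].

Definition add_sets (A : nuAlgType k) (U V : set A) : set A :=
  [set x + y | x in U & y in V].

Definition nu_lie (A : nuAlgType k) (x y : A) : A := x ** y - y ** x.

Definition nu_circ (A : nuAlgType k) (x y : A) : A := x ** y + y ** x.

End NuAlgebraTheory.

(* k_0<X> is the augmentation ideal of the unitary free algebra k<X>; the
   variables are indexed from 0, so that var k i is the informal x_(i+1). *)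
Section FreeNuAlgebra.
Variable k : fieldType.

Local Notation free_alg := {malg k[{fmonom nat}]}.

Lemma free_scalerAr (a : k) (f g : free_alg) : f * (a *: g) = a *: (f * g).
Proof.
apply/malgP => m.
rewrite [LHS](mcoeffMlw m (fsubset_refl _) (msuppZ_le a _)).
rewrite mcoeffZ mcoeffMl mulr_sumr.
apply: eq_bigr => i _; rewrite mulr_sumr; apply: eq_bigr => j _.
by rewrite mcoeffZ mulrCA mulrnAr.
Qed.

Definition free0_pred : {pred free_alg} :=
  fun f => f@_(mone : {fmonom nat}) == 0.
Arguments free0_pred : simpl never.

Lemma free0_submod : submod_closed free0_pred.
Proof.
split; first by rewrite unfold_in mcoeff0.
by move=> a x y; rewrite !unfold_in => /eqP hx /eqP hy;
   rewrite mcoeffD mcoeffZ hx hy mulr0 addr0.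
Qed.
HB.instance Definition _ := GRing.isSubmodClosed.Build k free_alg free0_pred
  free0_submod.

Lemma free0_mull (f g : free_alg) : f \in free0_pred -> f * g \in free0_pred.
Proof. by rewrite !unfold_in => /eqP h; rewrite (rmorphM (mcoeff mone)) /= h mul0r. Qed.

Record free0 := Free0 {free0_val :> free_alg; _ : free0_val \in free0_pred}.
HB.instance Definition _ := [isSub for free0_val].
HB.instance Definition _ := [Choice of free0 by <:].
HB.instance Definition _ := [SubChoice_isSubLmodule of free0 by <:].

Definition free0_mul (f g : free0) : free0 := Free0 (free0_mull (val g) (valP f)).

Lemma free0_mulA : associative free0_mul.
Proof. by move=> x y z; apply/val_inj; rewrite /= mulrA. Qed.
Lemma free0_mulDl : left_distributive free0_mul +%R.
Proof. by move=> x y z; apply/val_inj; rewrite /= mulrDl. Qed.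
Lemma free0_mulDr : right_distributive free0_mul +%R.
Proof. by move=> x y z; apply/val_inj; rewrite /= mulrDr. Qed.
Lemma free0_mulZl (a : k) (x y : free0) :
  free0_mul (a *: x) y = a *: free0_mul x y.
Proof. by apply/val_inj; rewrite /= scalerAl. Qed.
Lemma free0_mulZr (a : k) (x y : free0) :
  free0_mul x (a *: y) = a *: free0_mul x y.
Proof. by apply/val_inj; rewrite /= free_scalerAr. Qed.
HB.instance Definition _ := Lmodule_isNuAlgebra.Build k free0
  free0_mulA free0_mulDl free0_mulDr free0_mulZl free0_mulZr.

Lemma var_subproof i : << fmu i >> \in free0_pred.
Proof. by rewrite unfold_in mcoeffU1 fm1_eq1. Qed.
Definition var (i : nat) : free0 := Free0 (var_subproof i).

End FreeNuAlgebra.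

Lemma bilinear_assoc (k : fieldType) (V : lmodType k) (I : Type) (b : I -> V)
    (m : V -> V -> V) :
    (forall P : V -> Prop, P 0 ->
      (forall a i u, P u -> P (a *: b i + u)) -> forall u, P u) ->
    (forall a u u' v, m (a *: u + u') v = a *: m u v + m u' v) ->
    (forall a u v v', m u (a *: v + v') = a *: m u v + m u v') ->
    (forall v, m 0 v = 0) -> (forall u, m u 0 = 0) ->
    (forall i j l, m (b i) (m (b j) (b l)) = m (m (b i) (b j)) (b l)) ->
  associative m.
Proof.
move=> ind mPl mPr m0l m0r mA u v w.
elim/ind: u v w => [|a A u IHu] v w; first by rewrite !m0l.
rewrite !mPl IHu; congr (a *: _ + _) => {u IHu}.
elim/ind: v w => [|c B v IHv] w; first by rewrite m0l !m0r m0l.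
rewrite !(mPl, mPr) IHv; congr (c *: _ + _) => {v IHv}.
elim/ind: w => [|d C w IHw]; first by rewrite !m0r.
by rewrite !mPr IHw mA.
Qed.

(* The basis element << A >> stands for the increasing product of the e_i, i in
   A, and e_A e_B is up to sign e_(A u B), or 0 when A and B meet. *)
Section Grassmann.
Variable k : fieldType.

Definition grassmann := {malg k[{fset nat}]}.
HB.instance Definition _ := GRing.Lmodule.on grassmann.

Definition ginv (A B : {fset nat}) : nat :=
  (\sum_(a <- A) \sum_(b <- B) (b < a))%N.

Definition gmulU (A B : {fset nat}) : grassmann :=
  if [disjoint A & B]%fset then << (-1) ^+ ginv A B *g (A `|` B)%fset >> else 0.

Definition gmul (u v : grassmann) : grassmann :=
  \sum_(A <- msupp u) \sum_(B <- msupp v) (u@_A * v@_B) *: gmulU A B.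

Lemma grassmann_ind (P : grassmann -> Prop) :
    P 0 -> (forall a A (u : grassmann), P u -> P (a *: (<< A >> : grassmann) + u)) ->
  forall u, P u.
Proof.
move=> P0 PS u; rewrite (monalgE u).
elim: (X in \sum_(_ <- X) _) => [|A s IH]; first by rewrite big_nil.
rewrite big_cons.
suff -> : << u@_A *g A >> = u@_A *: (<< A >> : grassmann) by exact: PS.
by apply/malgP => B; rewrite [RHS]mcoeffZ 2!mcoeffU mulrnAr mulr1.
Qed.

Lemma gmulEw (d1 d2 : {fset {fset nat}}) (u v : grassmann) :
    (msupp u `<=` d1)%fset -> (msupp v `<=` d2)%fset ->
  gmul u v = \sum_(A <- d1) \sum_(B <- d2) (u@_A * v@_B) *: gmulU A B.
Proof.
move=> h1 h2; rewrite /gmul.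
rewrite (big_fset_incl _ h1) /=; last first.
  move=> A _ /mcoeff_outdom ->.
  by rewrite big1 // => B _; rewrite mul0r scale0r.
apply: eq_bigr => A _.
by rewrite (big_fset_incl _ h2) //= => B _ /mcoeff_outdom ->; rewrite mulr0 scale0r.
Qed.

Lemma gmulPl a (u u' v : grassmann) :
  gmul (a *: u + u') v = a *: gmul u v + gmul u' v.
Proof.
pose d := (msupp u `|` msupp u' `|` msupp (a *: u + u'))%fset.
have h1 : (msupp u `<=` d)%fset by rewrite /d -fsetUA fsubsetUl.
have h2 : (msupp u' `<=` d)%fset by rewrite /d fsetUAC fsubsetUr.
have h3 : (msupp (a *: u + u') `<=` d)%fset by rewrite /d fsubsetUr.
rewrite (gmulEw h1 (fsubset_refl _)) (gmulEw h2 (fsubset_refl _)).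
rewrite (gmulEw h3 (fsubset_refl _)) scaler_sumr -big_split /=.
apply: eq_bigr => A _; rewrite scaler_sumr -big_split /=.
apply: eq_bigr => B _.
by rewrite mcoeffD mcoeffZ mulrDl scalerDl -mulrA scalerA.
Qed.

Lemma gmulPr a (u v v' : grassmann) :
  gmul u (a *: v + v') = a *: gmul u v + gmul u v'.
Proof.
pose d := (msupp v `|` msupp v' `|` msupp (a *: v + v'))%fset.
have h1 : (msupp v `<=` d)%fset by rewrite /d -fsetUA fsubsetUl.
have h2 : (msupp v' `<=` d)%fset by rewrite /d fsetUAC fsubsetUr.
have h3 : (msupp (a *: v + v') `<=` d)%fset by rewrite /d fsubsetUr.
rewrite (gmulEw (fsubset_refl _) h1) (gmulEw (fsubset_refl _) h2).
rewrite (gmulEw (fsubset_refl _) h3) scaler_sumr -big_split /=.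
apply: eq_bigr => A _; rewrite scaler_sumr -big_split /=.
apply: eq_bigr => B _.
by rewrite mcoeffD mcoeffZ mulrDr scalerDl mulrCA scalerA.
Qed.

Lemma gmul0l v : gmul 0 v = 0.
Proof. by rewrite /gmul msupp0 big_nil. Qed.
Lemma gmul0r u : gmul u 0 = 0.
Proof. by rewrite /gmul msupp0 big1 // => A _; rewrite big_nil. Qed.
Lemma gmulDl : left_distributive gmul +%R.
Proof. by move=> u v w; rewrite -[u]scale1r gmulPl !scale1r. Qed.
Lemma gmulDr : right_distributive gmul +%R.
Proof. by move=> u v w; rewrite -[v]scale1r gmulPr !scale1r. Qed.
Lemma gmulZl a u v : gmul (a *: u) v = a *: gmul u v.
Proof. by rewrite -[a *: u]addr0 gmulPl gmul0l addr0. Qed.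
Lemma gmulZr a u v : gmul u (a *: v) = a *: gmul u v.
Proof. by rewrite -[a *: v]addr0 gmulPr gmul0r addr0. Qed.

Lemma gmulUU A B : gmul << A >> << B >> = gmulU A B.
Proof.
rewrite /gmul !msuppU oner_eq0 !big_seq_fset1 !mcoeffUU.
by rewrite mulr1 scale1r.
Qed.

Lemma perm_fsetU (A B : {fset nat}) : [disjoint A & B]%fset ->
  perm_eq (A `|` B)%fset (A ++ B).
Proof.
move=> /fdisjointP dAB; apply: uniq_perm => [||x].
- exact: fset_uniq.
- rewrite cat_uniq !fset_uniq /= andbT; apply/hasPn => x xB.
  by apply/negP => /dAB; rewrite xB.
- by rewrite mem_cat in_fsetU.
Qed.

Lemma ginvUl (A B C : {fset nat}) : [disjoint A & B]%fset ->
  ginv (A `|` B)%fset C = (ginv A C + ginv B C)%N.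
Proof. by move=> dAB; rewrite /ginv (perm_big _ (perm_fsetU dAB)) big_cat. Qed.

Lemma ginvUr (A B C : {fset nat}) : [disjoint A & B]%fset ->
  ginv C (A `|` B)%fset = (ginv C A + ginv C B)%N.
Proof.
move=> dAB; rewrite /ginv -big_split /=; apply: eq_bigr => c _.
by rewrite (perm_big _ (perm_fsetU dAB)) big_cat.
Qed.

Lemma gmulUE A B :
  gmulU A B = ([disjoint A & B]%fset%:R * (-1) ^+ ginv A B) *:
    (<< (A `|` B)%fset >> : grassmann).
Proof.
rewrite /gmulU; case: ifP => _; last by rewrite mul0r scale0r.
by apply/malgP => C; rewrite mul1r [RHS]mcoeffZ 2!mcoeffU mulrnAr mulr1.
Qed.

Lemma gmulUA A B C :
  gmul << A >> (gmul << B >> << C >>) = gmul (gmul << A >> << B >>) << C >>.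
Proof.
rewrite !gmulUU (gmulUE A B) (gmulUE B C) gmulZl gmulZr !gmulUU !gmulUE.
rewrite !scalerA fsetUA fdisjointXU fdisjointUX.
case: (boolP [disjoint A & B]%fset) => dAB; last by rewrite /= !(mul0r, mulr0).
case: (boolP [disjoint B & C]%fset) => dBC; last first.
  by rewrite andbF /= !(mul0r, mulr0).
rewrite [in LHS](ginvUr A dBC) [in RHS](ginvUl C dAB) 2!exprD andbT; congr (_ *: _).
move: ((-1) ^+ _) ((-1) ^+ _) ((-1) ^+ _) => x y z /=.
rewrite -!mulrA; congr (_ * _).
rewrite (mulrCA z) (mulrCA y); congr (_ * _).
by rewrite (mulrC x) mulrCA.
Qed.

Lemma gmulA : associative gmul.
Proof.
exact: bilinear_assoc grassmann_ind gmulPl gmulPr gmul0l gmul0r gmulUA.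
Qed.

Lemma ginv0l B : ginv fset0 B = 0%N.
Proof. by rewrite /ginv big_nil. Qed.
Lemma ginv0r A : ginv A fset0 = 0%N.
Proof. by rewrite /ginv big1 // => a _; rewrite big_nil. Qed.

Definition gone : grassmann := << fset0 >>.

Lemma gmul1l : left_id gone gmul.
Proof.
move=> u; elim/grassmann_ind: u => [|a A u IHu]; first by rewrite gmul0r.
rewrite gmulPr IHu gmulUU /gmulU ginv0l fset0U.
by rewrite fdisjoint0X.
Qed.
Lemma gmul1r : right_id gone gmul.
Proof.
move=> u; elim/grassmann_ind: u => [|a A u IHu]; first by rewrite gmul0l.
rewrite gmulPl IHu gmulUU /gmulU ginv0r fsetU0.
by rewrite fdisjointX0.
Qed.
Lemma gone_neq0 : gone != 0.
Proof. by rewrite monalgU_eq0 oner_eq0. Qed.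

HB.instance Definition _ := GRing.Zmodule_isNzRing.Build grassmann
  gmulA gmul1l gmul1r gmulDl gmulDr gone_neq0.
HB.instance Definition _ := GRing.Lmodule_isLalgebra.Build k grassmann
  (fun a u v => esym (gmulZl a u v)).
HB.instance Definition _ := GRing.Lalgebra_isAlgebra.Build k grassmann
  (fun a u v => esym (gmulZr a u v)).

Definition ggen (i : nat) : grassmann := << [fset i]%fset >>.

Lemma ggen_sqr i : ggen i * ggen i = 0.
Proof.
apply: etrans (gmulUU _ _) _; rewrite /gmulU ifF //.
by apply/negP => /fdisjointP /(_ i); rewrite fset11 => /(_ isT).
Qed.

Lemma ggenM i j : i != j ->
  ggen i * ggen j = << (-1) ^+ (j < i)%N *g [fset i; j]%fset >>.
Proof.
move=> ij; apply: etrans (gmulUU _ _) _.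
have dij : [disjoint [fset i] & [fset j]]%fset by rewrite fdisjoint1X inE.
by rewrite /gmulU dij /ginv big_seq_fset1 big_seq_fset1.
Qed.

Lemma ggen_anticomm i j : ggen i * ggen j = - (ggen j * ggen i).
Proof.
have [->|ij] := eqVneq i j; first by rewrite ggen_sqr oppr0.
have ji : j != i by rewrite eq_sym.
rewrite (ggenM ij) (ggenM ji) -monalgUN [in RHS]fsetUC; congr << _ *g _ >>.
by case: ltngtP ij => // _ _; rewrite expr0 expr1 ?opprK.
Qed.

Lemma ggen_basis (s : seq nat) : sorted ltn s ->
  \prod_(i <- s) ggen i = << [fset i in s]%fset >>.
Proof.
elim: s => [|i s IH] /= => [_|p].
  rewrite big_nil; congr << _ >>.
  by apply/fsetP => x; rewrite !inE.
rewrite big_cons (IH (path_sorted p)); apply: etrans (gmulUU _ _) _.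
have lt_i j : j \in s -> (i < j)%N.
  by move: p; rewrite (path_sortedE ltn_trans) => /andP[/allP h _] /h.
rewrite /gmulU ifT; last first.
  by rewrite fdisjoint1X inE; apply/negP => /lt_i; rewrite ltnn.
have -> : ginv [fset i]%fset [fset j in s]%fset = 0%N.
  rewrite /ginv big_seq_fset1 big_seq big1 // => j.
  by rewrite inE => /lt_i h; rewrite ltnNge ltnW.
by congr << _ >>; apply/fsetP => x; rewrite !inE.
Qed.

Definition grassmann0_pred : {pred grassmann} :=
  fun u => u@_(fset0 : {fset nat}) == 0.
Arguments grassmann0_pred : simpl never.

Lemma grassmann0_submod : submod_closed grassmann0_pred.
Proof.
split; first by rewrite unfold_in mcoeff0.
by move=> a x y; rewrite !unfold_in => /eqP hx /eqP hy;
   rewrite mcoeffD mcoeffZ hx hy mulr0 addr0.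
Qed.
HB.instance Definition _ := GRing.isSubmodClosed.Build k grassmann
  grassmann0_pred grassmann0_submod.

Lemma grassmann0_mull (u v : grassmann) :
  u \in grassmann0_pred -> u * v \in grassmann0_pred.
Proof.
rewrite !unfold_in => /eqP u0.
rewrite [u * v]/(gmul u v) /gmul raddf_sum big_seq big1 //= => A Au.
rewrite raddf_sum big1 // => B _; rewrite /= [LHS]mcoeffZ /gmulU.
case: ifP => _; last by rewrite mcoeff0 mulr0.
rewrite mcoeffU fsetU_eq0; case: eqP => [A0|_]; last by rewrite mulr0n mulr0.
by move: Au; rewrite A0 -mcoeff_neq0 u0 eqxx.
Qed.

Record grassmann0 := Grassmann0 {
  grassmann0_val :> grassmann;
  _ : grassmann0_val \in grassmann0_pred
}.
HB.instance Definition _ := [isSub for grassmann0_val].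
HB.instance Definition _ := [Choice of grassmann0 by <:].
HB.instance Definition _ := [SubChoice_isSubLmodule of grassmann0 by <:].

Definition grassmann0_mul (u v : grassmann0) : grassmann0 :=
  Grassmann0 (grassmann0_mull (val v) (valP u)).

Lemma grassmann0_mulA : associative grassmann0_mul.
Proof. by move=> x y z; apply/val_inj; rewrite /= mulrA. Qed.
Lemma grassmann0_mulDl : left_distributive grassmann0_mul +%R.
Proof. by move=> x y z; apply/val_inj; rewrite /= mulrDl. Qed.
Lemma grassmann0_mulDr : right_distributive grassmann0_mul +%R.
Proof. by move=> x y z; apply/val_inj; rewrite /= mulrDr. Qed.
Lemma grassmann0_mulZl (a : k) (x y : grassmann0) :
  grassmann0_mul (a *: x) y = a *: grassmann0_mul x y.
Proof. by apply/val_inj; rewrite /= scalerAl. Qed.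
Lemma grassmann0_mulZr (a : k) (x y : grassmann0) :
  grassmann0_mul x (a *: y) = a *: grassmann0_mul x y.
Proof. by apply/val_inj; rewrite /= scalerAr. Qed.
HB.instance Definition _ := Lmodule_isNuAlgebra.Build k grassmann0
  grassmann0_mulA grassmann0_mulDl grassmann0_mulDr
  grassmann0_mulZl grassmann0_mulZr.

Lemma ggen_subproof i : ggen i \in grassmann0_pred.
Proof.
rewrite unfold_in mcoeffU (_ : [fset i]%fset == fset0 = false) //.
by apply/negP => /eqP /fsetP /(_ i); rewrite !inE eqxx.
Qed.
Definition gen (i : nat) : grassmann0 := Grassmann0 (ggen_subproof i).

(* The generators e_1, ..., e_m are gen 0, ..., gen m.-1. *)
Definition grassmann0_fin (m : nat) : set grassmann0 :=
  smallest (@is_nu_subalgebra k grassmann0) (gen @` `I_m).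

End Grassmann.

Section CentralPolynomials.
Variable k : fieldType.

Definition is_Tspace (V : set (free0 k)) : Prop :=
  is_subspace V /\
  forall phi : {linear free0 k -> free0 k}, nu_morphism phi ->
    forall f, V f -> V (phi f).

Definition Tspan (A : set (free0 k)) : set (free0 k) := smallest is_Tspace A.

(* Homomorphisms k_0<X> -> G_0(m) are homomorphisms into G_0 with image in
   G_0(m). *)
Definition hom_fin (m : nat) (phi : {linear free0 k -> grassmann0 k}) : Prop :=
  nu_morphism phi /\ forall f, grassmann0_fin m (phi f).

Definition T_ideal (m : nat) : set (free0 k) :=
  [set f | forall phi : {linear free0 k -> grassmann0 k},
     hom_fin m phi -> phi f = 0].

Definition central_polynomial (m : nat) : set (free0 k) :=
  [set f | ~ T_ideal m f /\
     forall phi : {linear free0 k -> grassmann0 k},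
       hom_fin m phi -> nu_center (grassmann0_fin m) (phi f)].

Definition CP (m : nat) : set (free0 k) := Tspan (central_polynomial m).

Definition lie01 : free0 k := nu_lie (var k 0) (var k 1).

Lemma w_subproof (p n : nat) :
  \prod_(j < n.+1) (val (nu_lie (var k j.*2) (var k j.*2.+1)) *
    val (var k j.*2) ^+ (p - 1) * val (var k j.*2.+1) ^+ (p - 1))
  \in @free0_pred k.
Proof. by rewrite big_ord_recl -!mulrA; apply/free0_mull/valP. Qed.

(* The informal w_(n+1). *)
Definition w (p n : nat) : free0 k := Free0 (w_subproof p n).

(* x_1 o ... o x_n, left-normed; only meaningful for n >= 1. *)
Fixpoint circ_prod (n : nat) : free0 k :=
  match n with
  | 0 => 0
  | 1 => var k 0
  | n'.+1 => nu_circ (circ_prod n') (var k n')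
  end.

Definition S_space (p : nat) : set (free0 k) :=
  if p == 0%N then Tspan [set lie01]
  else add_sets (Tspan [set lie01]) (Tspan (range (w p))).

Definition Sm_space (p m : nat) : set (free0 k) :=
  if odd m then add_sets (S_space p) (Tspan [set circ_prod (m.+1 %/ 2)])
  else S_space p.

Definition U_space (p m : nat) : set (free0 k) := add_sets (Sm_space p m) (T_ideal m).

Definition has_characteristic (p : nat) : Prop :=
  if p == 0%N then [pchar k] =i pred0 else p \in [pchar k].

End CentralPolynomials.

Arguments CP : clear implicits.
Arguments U_space : clear implicits.

(* Main.v *)
Require Import Defs.
From HB Require Import structures.
From mathcomp Require Import all_boot all_order all_algebra finmap.
From mathcomp Require Import boolp classical_sets monalg zify.

(** Modulo the identities of the Grassmann algebra, the free algebra is an algebra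
    of differential forms: write the value of x_i as t_i + xi_i, even plus odd, with
    xi_i = d t_i.  Every element takes a value of the shape omega + d omega with
    omega an even form, so it is central for the infinite Grassmann algebra exactly
    when omega is closed, and commutators give exactly the exact forms.  The complex
    splits by multidegree b into a tensor product of two-term complexes
    t_i^b_i -> t_i^(b_i - 1) xi_i, the differential being multiplication by b_i.
    If some b_i is invertible in k the complex is contractible; otherwise t_i^p = 0
    only leaves the classes prod t_i^(p-1) xi_i, which are the w_n.

    In G_0(m) give t_i weight 2 and xi_i weight 1.  Forms of weight above m vanish,
    and d omega may be nonzero on the top product e_1 ... e_m.  Hence, for odd m, the
    component of omega of weight m + 1 is unconstrained: it is spanned by products of
    (m + 1)/2 even factors t_i or xi_i xi_j, that is, by the values of
    x_1 o ... o x_((m+1)/2). *)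

(** The closed forms are never computed inside the free algebra. Modulo [U_space] every polynomial
    is reduced to a combination of normal monomials, a family on which the differential is injective
    with values of weight below m. An element of G_0(m) is central exactly when its odd part lives
    in degree m, so the combination left over from a central polynomial has zero differential and is
    itself zero. The obstacle is to lift an even form to a polynomial. The value of a word in the
    x_i mixes several forms; the Jordan product with x_i cancels the unwanted term xi_i d(t^s),
    because xi_i and d(t^s) anticommute. Jordan products of variables and half commutators therefore
    take exactly the values omega + d omega with omega = t^s xi_J. Dividing by 2 here, and passing
    from 2 v e_i = 0 to v e_i = 0 in the description of the centre, is where p <> 2 enters. *)

Set Implicit Arguments.
Unset Strict Implicit.
Unset Printing Implicit Defensive.

Import GRing.Theory.

Local Open Scope fset_scope.
Local Open Scope classical_set_scope.
Local Open Scope ring_scope.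

(** * Free algebras *)

(* What is needed of k<X>; on the concrete algebra unification would unfold the
   ring operations. *)
Record free_model (k : fieldType) := FreeModel {
  free_sort :> algType k;
  fgen : nat -> free_sort;
  free_const : free_sort -> k;
  free_subst : forall A : algType k, (nat -> A) -> free_sort -> A;
  free_const_linear : scalar free_const;
  free_const_multiplicative : multiplicative free_const;
  free_constX : forall i, free_const (fgen i) = 0;
  free_subst_linear : forall (A : algType k) (u : nat -> A), linear (free_subst u);
  free_subst_multiplicative : forall (A : algType k) (u : nat -> A),
    multiplicative (free_subst u);
  free_substX : forall (A : algType k) (u : nat -> A) i, free_subst u (fgen i) = u i;
  free_ind : forall P : free_sort -> Prop,
    P 0 -> (forall a f g, P f -> P g -> P (a *: f + g)) ->
    P 1 -> (forall i f, P f -> P (fgen i * f)) ->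
    forall f, P f
}.

Definition fconst (k : fieldType) (F : free_model k) (f : F) : k := free_const f.
Definition subst (k : fieldType) (F : free_model k) (A : algType k) (u : nat -> A)
  (f : F) : A := free_subst u f.
Arguments fgen : simpl never.
Arguments fconst : simpl never.
Arguments subst : simpl never.

Section Morphisms.
Variables (k : fieldType) (F : free_model k) (A : algType k) (u : nat -> A).
HB.instance Definition _ := GRing.isLinear.Build k (free_sort F) k *%R (@fconst k F)
  (@free_const_linear k F).
HB.instance Definition _ := GRing.isMultiplicative.Build (free_sort F) k (@fconst k F)
  (@free_const_multiplicative k F).
HB.instance Definition _ := GRing.isLinear.Build k (free_sort F) A *:%R (@subst k F A u)
  (@free_subst_linear k F A u).
HB.instance Definition _ := GRing.isMultiplicative.Build (free_sort F) A (@subst k F A u)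
  (@free_subst_multiplicative k F A u).
End Morphisms.

Lemma fconstX (k : fieldType) (F : free_model k) i : fconst (fgen F i) = 0.
Proof. exact: free_constX. Qed.

Lemma substX (k : fieldType) (F : free_model k) (A : algType k) (u : nat -> A) i :
  subst u (fgen F i) = u i.
Proof. exact: free_substX. Qed.

Section FreeAlgebra.
Variable k : fieldType.

(* An alias, because [malg] already carries an algebra structure in the library,
   but only over commutative monomials. *)
Definition freealg := {malg k[{fmonom nat}]}.
HB.instance Definition _ := GRing.Lalgebra.on freealg.
HB.instance Definition _ := GRing.Lalgebra_isAlgebra.Build k freealg
  (fun a (f g : freealg) => esym (free_scalerAr a f g)).
Local Notation F := freealg.

Definition freeX (i : nat) : F := << fmu i >>.

Definition freealg_const (f : F) : k :=
  mcoeff (mone : {fmonom nat}) (f : {malg k[{fmonom nat}]}).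

Fact freealg_const_linear : scalar freealg_const.
Proof. by move=> a f g; rewrite /freealg_const mcoeffD mcoeffZ. Qed.

Fact freealg_const_multiplicative : multiplicative freealg_const.
Proof.
split=> [f g|]; first exact: (rmorphM (mcoeff (mone : {fmonom nat}))).
exact: (rmorph1 (mcoeff (mone : {fmonom nat}))).
Qed.

Lemma freealg_constX i : freealg_const (freeX i) = 0.
Proof. by rewrite /freealg_const mcoeffU1 fm1_eq1. Qed.

Lemma freealg_ind (P : F -> Prop) :
    P 0 -> (forall a f g, P f -> P g -> P (a *: f + g)) ->
    P 1 -> (forall i f, P f -> P (freeX i * f)) ->
  forall f, P f.
Proof.
move=> P0 PL P1 PX f.
have -> : f = \sum_(w <- msupp f) mcoeff w f *: (<< w >> : F).
  apply: etrans (monalgE f) _; apply: eq_bigr => w _.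
  apply/malgP => v; apply: etrans (mcoeffU _ _ _) _.
  apply: etrans _ (esym (mcoeffZ _ _ _)).
  by rewrite -mulr_natr; congr (_ * _); apply/esym/mcoeffU.
elim: (enum_fset (msupp f)) => [|w s IH]; first by rewrite big_nil.
rewrite big_cons; apply: PL IH.
rewrite -[w]fmK.
elim: (w : seq nat) => [|i v IH].
  by move: P1; congr P; congr << _ >>; rewrite -fmoneE.
suff -> : << FMonom (i :: v) >> = freeX i * << FMonom v >> :> F by exact: PX.
rewrite [RHS]malgME !msuppU oner_eq0 !big_seq_fset1 !mcoeffUU mulr1.
by congr << _ >>; apply/val_inj; apply: (etrans _ (esym (fmM _ _))); rewrite fmU.
Qed.

Section Eval.
Variable A : algType k.
Implicit Type u : nat -> A.

Definition word_prod u (w : {fmonom nat}) : A := \prod_(i <- (w : seq nat)) u i.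

Lemma word_prod_mmorphism u : mmorphism (word_prod u).
Proof.
split=> [x y|]; first by rewrite /word_prod fmM big_cat.
by rewrite /word_prod fm1 big_nil.
Qed.
HB.instance Definition _ u :=
  isMultiplicative.Build {fmonom nat} A (word_prod u) (word_prod_mmorphism u).

Definition freealg_subst u : F -> A := mmap (in_alg A) (word_prod u).

Lemma freealg_subst_linear u : linear (freealg_subst u).
Proof.
move=> a f g; apply: etrans (mmapD _ _) _; congr (_ + _).
by apply: etrans (mmapZ _ _) _; rewrite /= -scalerAl mul1r.
Qed.

Lemma freealg_subst_multiplicative u : multiplicative (freealg_subst u).
Proof.
apply: commr_mmap_is_multiplicative => g m m'.
by rewrite /GRing.comm /= -scalerAl -scalerAr mul1r mulr1.
Qed.

Lemma freealg_substX u i : freealg_subst u (freeX i) = u i.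
Proof.
by rewrite /freealg_subst mmapU /= scale1r mul1r /word_prod fmU big_seq1.
Qed.

End Eval.

Definition freeM : free_model k := @FreeModel k freealg freeX freealg_const
  freealg_subst freealg_const_linear freealg_const_multiplicative freealg_constX
  freealg_subst_linear freealg_subst_multiplicative freealg_substX freealg_ind.

End FreeAlgebra.
Arguments freeM : simpl never.

(** * Products of commuting and anticommuting families *)

Lemma perm_rem (T : eqType) (x : T) (s1 s2 : seq T) :
  perm_eq s1 s2 -> perm_eq (rem x s1) (rem x s2).
Proof.
move=> p; have [x1|x1] := boolP (x \in s1); last first.
  by rewrite !rem_id // -(perm_mem p).
rewrite -(perm_cons x) perm_sym (perm_trans _ (perm_to_rem x1)) //.
by rewrite perm_sym (perm_trans p) // perm_to_rem // -(perm_mem p).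
Qed.

Section Forms.
Variables (A : nzRingType) (t xi : nat -> A).
Hypothesis tC : forall i (y : A), t i * y = y * t i.
Hypothesis xiN : forall i j, xi i * xi j = - (xi j * xi i).

Definition tprod (s : seq nat) : A := \prod_(i <- s) t i.
Definition xprod (J : seq nat) : A := \prod_(j <- J) xi j.
(** This is d(t^s). The sum runs over occurrences, so a repeated index counts with its multiplicity;
    this is how the exponents enter k as scalars. *)
Definition dtprod (s : seq nat) : A := \sum_(i <- s) tprod (rem i s) * xi i.

Lemma tprod_cons i s : tprod (i :: s) = t i * tprod s.
Proof. by rewrite /tprod big_cons. Qed.

Lemma tprod_cat s1 s2 : tprod (s1 ++ s2) = tprod s1 * tprod s2.
Proof. by rewrite /tprod big_cat. Qed.

Lemma xprod_cons j J : xprod (j :: J) = xi j * xprod J.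
Proof. by rewrite /xprod big_cons. Qed.

Lemma tprodC s y : tprod s * y = y * tprod s.
Proof.
elim: s => [|i s IH]; first by rewrite /tprod big_nil mul1r mulr1.
by rewrite tprod_cons -mulrA IH mulrA tC -mulrA -tprod_cons tprod_cons mulrA.
Qed.

Lemma tprod_rem i s : i \in s -> tprod s = t i * tprod (rem i s).
Proof.
elim: s => // j s IH /=; rewrite inE eq_sym; case: (eqVneq j i) => [-> _|ji].
  by rewrite tprod_cons.
move=> /= /IH h; rewrite !tprod_cons h !mulrA; congr (_ * _).
exact: tC.
Qed.

Lemma tprod_perm s1 s2 : perm_eq s1 s2 -> tprod s1 = tprod s2.
Proof.
elim: s1 s2 => [|i s1 IH] s2 p.
  by move: p; rewrite perm_sym => /perm_nilP ->.
have i2 : i \in s2 by rewrite -(perm_mem p) mem_head.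
rewrite tprod_cons (tprod_rem i2) (IH (rem i s2)) //.
by rewrite -(perm_cons i) (perm_trans p) // perm_to_rem.
Qed.

Lemma tprod_rem_cons l j s : l \in s -> tprod (rem l (j :: s)) = t j * tprod (rem l s).
Proof.
by move=> ls /=; case: eqVneq => [->|_]; rewrite ?tprod_cons // -tprod_rem.
Qed.

Lemma dtprod_nil : dtprod [::] = 0.
Proof. by rewrite /dtprod big_nil. Qed.

Lemma dtprod_cons j s : dtprod (j :: s) = tprod s * xi j + t j * dtprod s.
Proof.
rewrite /dtprod big_cons /= eqxx mulr_sumr; congr (_ + _).
by apply: eq_big_seq => l ls; rewrite tprod_rem_cons // mulrA.
Qed.

Lemma dtprod_cat s1 s2 :
  dtprod (s1 ++ s2) = dtprod s1 * tprod s2 + tprod s1 * dtprod s2.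
Proof.
elim: s1 => [|j s IH].
  by rewrite dtprod_nil mul0r add0r /tprod big_nil mul1r.
rewrite /= !dtprod_cons IH tprod_cons tprod_cat mulrDr mulrDl !mulrA addrA.
by congr (_ + _ + _); rewrite -mulrA (tprodC s2) mulrA.
Qed.

Lemma dtprod_perm s1 s2 : perm_eq s1 s2 -> dtprod s1 = dtprod s2.
Proof.
move=> p; rewrite /dtprod (perm_big _ p) /=; apply: eq_bigr => l _.
by congr (_ * _); apply/tprod_perm/perm_rem.
Qed.

Lemma dtprod_xi s j : dtprod s * xi j = - (xi j * dtprod s).
Proof.
rewrite /dtprod mulr_suml mulr_sumr -sumrN; apply: eq_bigr => l _.
by rewrite -mulrA xiN mulrN !mulrA tprodC.
Qed.

(** This is d o d = 0. After peeling off j, the two contributions left are d(t^s) xi_j and xi_j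
    d(t^s), which cancel. *)
Lemma dtprod_closed s : \sum_(l <- s) dtprod (rem l s) * xi l = 0.
Proof.
elim: s => [|j s IH]; first by rewrite big_nil.
rewrite big_cons /= eqxx.
transitivity (dtprod s * xi j +
    \sum_(l <- s) (xi j * (tprod (rem l s) * xi l) + t j * (dtprod (rem l s) * xi l))).
  congr (_ + _); apply: eq_big_seq => l ls.
  have -> : (if j == l then s else j :: rem l s) = rem l (j :: s) by [].
  rewrite (@dtprod_perm _ (j :: rem l s)); last first.
    rewrite /=; case: eqVneq => [->|//]; exact: perm_to_rem.
  by rewrite dtprod_cons mulrDl !mulrA (tprodC _ (xi j)).
rewrite big_split /= -!mulr_sumr IH mulr0 addr0 -/(dtprod s).
by rewrite dtprod_xi addNr.
Qed.

End Forms.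

Lemma mulr_signCA (A : nzRingType) (b : bool) (x y : A) :
  x * ((-1) ^+ b * y) = (-1) ^+ b * (x * y).
Proof. by case: b; rewrite ?expr0 ?expr1 ?mul1r // !mulN1r mulrN. Qed.

(* The sign does not depend on the anticommuting family, which is what allows
   to reorder a form before it is evaluated. *)
Lemma xprod_perm J1 J2 : perm_eq J1 J2 -> exists b : bool,
  forall (A : nzRingType) (xi : nat -> A),
    (forall i j, xi i * xi j = - (xi j * xi i)) ->
  xprod xi J1 = (-1) ^+ b * xprod xi J2.
Proof.
have remP j J : j \in J -> exists b : bool,
    forall (A : nzRingType) (xi : nat -> A),
      (forall i j, xi i * xi j = - (xi j * xi i)) ->
    xprod xi J = (-1) ^+ b * xprod xi (j :: rem j J).
  elim: J => // i J IH /=; rewrite inE eq_sym; case: (eqVneq i j) => [-> _|ij].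
    by exists false => A xi _; rewrite expr0 mul1r.
  move=> /= /IH [b hb]; exists (~~ b) => A xi xiN.
  rewrite xprod_cons (hb _ _ xiN) !xprod_cons.
  rewrite mulr_signCA mulrA xiN mulNr -mulrA.
  by case: b {hb}; rewrite ?expr0 ?expr1 ?mul1r ?mulN1r ?opprK.
elim: J1 J2 => [|j J1 IH] J2 p.
  move: p; rewrite perm_sym => /perm_nilP ->.
  by exists false => A xi _; rewrite expr0 mul1r.
have j2 : j \in J2 by rewrite -(perm_mem p) mem_head.
have [|b hb] := IH (rem j J2).
  by rewrite -(perm_cons j) (perm_trans p) // perm_to_rem.
have [c hc] := remP _ _ j2; exists (b (+) c) => A xi xiN.
rewrite (hc _ _ xiN) xprod_cons (hb _ _ xiN) xprod_cons mulr_signCA.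
by case: b {hb}; case: c {hc}; rewrite /= ?expr0 ?expr1 ?mul1r ?mulN1r ?opprK.
Qed.

Lemma xprod_uniq (A : nzRingType) (xi : nat -> A) J :
  (forall i j, xi i * xi j = - (xi j * xi i)) -> (forall i, xi i * xi i = 0) ->
  ~~ uniq J -> xprod xi J = 0.
Proof.
move=> xiN xi2; elim: J => //= j J IH.
rewrite negb_and negbK xprod_cons => /orP[jJ|/IH ->]; last by rewrite mulr0.
have [b hb] := xprod_perm (perm_to_rem jJ).
by rewrite (hb _ _ xiN) xprod_cons mulr_signCA mulrA xi2 mul0r mulr0.
Qed.

(** * Grassmann algebras *)

(* Abstract for the same reason as [free_model]; [gbas A] is the increasing product
   of the e_i, i in A. *)
Record grassmann_model (k : fieldType) := GrassmannModel {
  gm_sort :> algType k;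
  gcoef : {fset nat} -> {scalar gm_sort};
  gbas : {fset nat} -> gm_sort;
  gdom : gm_sort -> {fset {fset nat}};
  gcoefP : forall u v, (forall A, gcoef A u = gcoef A v) -> u = v;
  gcoef_bas : forall A B, gcoef B (gbas A) = (A == B)%:R;
  gbasM : forall A B, gbas A * gbas B =
    ([disjoint A & B]%fset%:R * (-1) ^+ ginv A B) *: gbas (A `|` B)%fset;
  gbas1 : gbas fset0 = 1;
  gcoef_dom : forall A u, (gcoef A u != 0) = (A \in gdom u);
  gexpand : forall u, u = \sum_(A <- gdom u) gcoef A u *: gbas A
}.

Section Concrete.
Variable k : fieldType.
Local Notation G := (grassmann k).
Implicit Types (u v : G) (A B : {fset nat}).

Definition grassmann_coef A u : k := mcoeff A (u : {malg k[{fset nat}]}).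
Definition grassmann_bas A : G := << A >>.

Fact grassmann_coef_linear A : scalar (grassmann_coef A).
Proof. by move=> a u v; rewrite /grassmann_coef mcoeffD mcoeffZ. Qed.
HB.instance Definition _ A := GRing.isLinear.Build k G k *%R (grassmann_coef A)
  (grassmann_coef_linear A).

Fact grassmann_coefP u v :
  (forall A, grassmann_coef A u = grassmann_coef A v) -> u = v.
Proof. by move=> h; apply/malgP. Qed.

Fact grassmann_coef_bas A B : grassmann_coef B (grassmann_bas A) = (A == B)%:R.
Proof. exact: mcoeffU. Qed.

Fact grassmann_basM A B : grassmann_bas A * grassmann_bas B =
  ([disjoint A & B]%fset%:R * (-1) ^+ ginv A B) *: grassmann_bas (A `|` B)%fset.
Proof. by rewrite -gmulUE -gmulUU. Qed.

Fact grassmann_coef_supp A u :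
  (grassmann_coef A u != 0) = (A \in (msupp u : {fset {fset nat}})).
Proof. exact: mcoeff_neq0. Qed.

Fact grassmann_expand u :
  u = \sum_(A <- msupp u) grassmann_coef A u *: grassmann_bas A.
Proof.
transitivity (\sum_(A <- msupp u) (<< grassmann_coef A u *g A >> : G)).
  exact: monalgE.
apply: eq_bigr => A _; apply: grassmann_coefP => B.
apply: etrans (mcoeffU _ _ _) _.
by rewrite [RHS]mcoeffZ [X in _ * X]mcoeffU mulr_natr.
Qed.

Definition grassmannM : grassmann_model k := @GrassmannModel k G
  (fun A => grassmann_coef A) grassmann_bas (fun u => msupp u) grassmann_coefP grassmann_coef_bas
  grassmann_basM erefl grassmann_coef_supp grassmann_expand.

End Concrete.
Arguments grassmannM : simpl never.

Section GrassmannSupport.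
Variables (k : fieldType) (G : grassmann_model k).
Implicit Types (u v : G) (A B : {fset nat}) (P Q R : pred {fset nat}).

Lemma gcoefL A (a : k) u v : gcoef G A (a *: u + v) = a * gcoef G A u + gcoef G A v.
Proof. exact: linearP. Qed.

Lemma gcoefZ A (a : k) u : gcoef G A (a *: u) = a * gcoef G A u.
Proof. exact: linearZ. Qed.

Definition gsupp P u : bool := all P (gdom u).

Lemma gsuppP P u : reflect (forall A, gcoef G A u != 0 -> P A) (gsupp P u).
Proof. by apply: (iffP allP) => h A hA; apply: h; rewrite ?gcoef_dom // -gcoef_dom. Qed.

Lemma gsupp0 P : gsupp P 0.
Proof. by apply/gsuppP => A; rewrite linear0 eqxx. Qed.

Lemma gsuppL P a u v : gsupp P u -> gsupp P v -> gsupp P (a *: u + v).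
Proof.
move=> /gsuppP hu /gsuppP hv; apply/gsuppP => A; rewrite gcoefL.
have [->|/hu //] := eqVneq (gcoef G A u) 0; rewrite mulr0 add0r; exact: hv.
Qed.

Lemma gsuppU P A : P A -> gsupp P (gbas G A).
Proof.
move=> PA; apply/gsuppP => B; rewrite gcoef_bas.
by case: (eqVneq A B) => [<- //|_]; rewrite eqxx.
Qed.

Lemma gsuppD P u v : gsupp P u -> gsupp P v -> gsupp P (u + v).
Proof. by move=> hu hv; rewrite -[u]scale1r; apply: gsuppL. Qed.

Lemma gsuppZ P a u : gsupp P u -> gsupp P (a *: u).
Proof. by move=> hu; rewrite -[_ *: _]addr0; apply/gsuppL/gsupp0. Qed.

Lemma gsupp_sum P (I : Type) (r : seq I) (C : pred I) (f : I -> G) :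
  (forall i, C i -> gsupp P (f i)) -> gsupp P (\sum_(i <- r | C i) f i).
Proof. by move=> h; elim/big_ind: _ => //; [apply: gsupp0|apply: gsuppD]. Qed.

Lemma gsuppW P Q u : subpred P Q -> gsupp P u -> gsupp Q u.
Proof. by move=> PQ /gsuppP hu; apply/gsuppP => A /hu /PQ. Qed.

Lemma gsuppI P Q u : gsupp P u -> gsupp Q u -> gsupp (predI P Q) u.
Proof.
move=> /gsuppP hP /gsuppP hQ; apply/gsuppP => A hA.
by apply/andP; split; [apply: hP|apply: hQ].
Qed.

Lemma gsupp_ind P (Phi : G -> Prop) :
    Phi 0 -> (forall a A u, P A -> Phi u -> Phi (a *: gbas G A + u)) ->
  forall u, gsupp P u -> Phi u.
Proof.
move=> Phi0 PhiL u hu; rewrite (gexpand u).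
have : {subset enum_fset (gdom u) <= P}.
  by move=> A hA; apply: (gsuppP _ _ hu); rewrite gcoef_dom.
elim: (enum_fset (gdom u)) => [|A s IH] sP; first by rewrite big_nil.
rewrite big_cons.
apply: PhiL; first exact/sP/mem_head.
by apply: IH => B Bs; apply: sP; rewrite inE Bs orbT.
Qed.

Lemma gsuppM P Q R u v :
    (forall A B, [disjoint A & B]%fset -> P A -> Q B -> R (A `|` B)%fset) ->
  gsupp P u -> gsupp Q v -> gsupp R (u * v).
Proof.
move=> PQR hu hv; move: u hu; apply: gsupp_ind => [|a A u PA IHu].
  by rewrite mul0r; apply: gsupp0.
rewrite mulrDl -scalerAl; apply: gsuppL IHu.
move: v hv; apply: gsupp_ind => [|b B v QB IHv].
  by rewrite mulr0; apply: gsupp0.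
rewrite mulrDr -scalerAr; apply: gsuppL IHv; rewrite gbasM.
case: (boolP [disjoint A & B]%fset) => dAB; last by rewrite mul0r scale0r; apply: gsupp0.
by apply/gsuppZ/gsuppU/PQR.
Qed.

Lemma ginvC A B : [disjoint A & B]%fset ->
  (ginv A B + ginv B A)%N = (#|` A| * #|` B|)%N.
Proof.
move=> /fdisjointP dAB; rewrite /ginv [X in (_ + X)%N]exchange_big -big_split /=.
transitivity (\sum_(a <- A) #|` B|)%N; last first.
  by rewrite big_const_seq count_predT iter_addn_0 mulnC.
apply: eq_big_seq => a aA; rewrite -big_split /=.
rewrite (eq_big_seq (fun=> 1%N)); last first.
  move=> b bB; case: (ltngtP a b) => // ab.
  by move: (dAB _ aA); rewrite ab bB.
by rewrite big_const_seq count_predT iter_addn_0 mul1n.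
Qed.

Lemma gmulUC A B : gbas G B * gbas G A = (-1) ^+ (#|` A| * #|` B|) *: (gbas G A * gbas G B).
Proof.
rewrite !gbasM scalerA fsetUC fdisjoint_sym; congr (_ *: _).
case: (boolP [disjoint A & B]%fset) => dAB; last by rewrite !mul0r mulr0.
rewrite !mul1r -(ginvC dAB) -(signr_odd _ (_ + _)) oddD.
rewrite -(signr_odd _ (ginv A B)) -(signr_odd _ (ginv B A)).
by case: (odd _); case: (odd _); rewrite ?expr0 ?expr1 ?mulr1 ?mulrN1 ?opprK.
Qed.

Definition card_parity (b : bool) : pred {fset nat} := fun A => odd #|` A| == b.
Notation even_supp := (gsupp (card_parity false)).
Notation odd_supp := (gsupp (card_parity true)).

Lemma gmulC_parity b c u v : gsupp (card_parity b) u -> gsupp (card_parity c) v ->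
  v * u = (-1) ^+ (b && c) *: (u * v).
Proof.
move=> hu hv; move: u hu; apply: gsupp_ind => [|a A u /eqP PA IHu].
  by rewrite mul0r mulr0 scaler0.
rewrite mulrDl mulrDr IHu scalerDr -scalerAl -scalerAr scalerA mulrC -scalerA.
congr (_ *: _ + _); move: v hv {IHu}; apply: gsupp_ind => [|d B v /eqP QB IHv].
  by rewrite mul0r mulr0 scaler0.
rewrite mulrDl mulrDr IHv scalerDr -scalerAl -scalerAr scalerA mulrC -scalerA.
by rewrite gmulUC -signr_odd oddM PA QB.
Qed.

Definition gpart (b : bool) u : G :=
  \sum_(A <- gdom u | card_parity b A) gcoef G A u *: gbas G A.

Lemma gcoef_gpart b u A :
  gcoef G A (gpart b u) = if card_parity b A then gcoef G A u else 0.
Proof.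
rewrite /gpart raddf_sum /=.
under eq_bigr => B _ do rewrite linearZ /= gcoef_bas.
have [As|As] := boolP (A \in gdom u).
  rewrite big_mkcond (big_rem A) //= eqxx mulr1 big_seq big1 ?addr0 // => B.
  rewrite mem_rem_uniq ?fset_uniq // inE => /andP[/negPf -> _].
  by rewrite mulr0 if_same.
rewrite big_seq_cond big1 => [|B /andP[Bs _]]; last first.
  by case: eqVneq => [BA|_]; rewrite ?mulr0 //; rewrite -BA Bs in As.
by move: As; rewrite -gcoef_dom negbK => /eqP ->; rewrite if_same.
Qed.

Lemma gpart_linear b : linear (gpart b).
Proof.
move=> a u v; apply/gcoefP => A.
rewrite gcoefL !gcoef_gpart gcoefL.
by case: ifP => _ //; rewrite mulr0 addr0.
Qed.
HB.instance Definition _ b := GRing.isLinear.Build k G G *:%R (gpart b)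
  (gpart_linear b).

Lemma gpart_parity b u : gsupp (card_parity b) (gpart b u).
Proof. by apply/gsuppP => A; rewrite gcoef_gpart; case: ifP => //; rewrite eqxx. Qed.

Lemma gpart_id b u : gsupp (card_parity b) u -> gpart b u = u.
Proof.
move=> /gsuppP hu; apply/gcoefP => A; rewrite gcoef_gpart; case: ifPn => // PA.
by apply/esym/eqP; apply: contraNT PA => /hu.
Qed.

Lemma gpart_neq b u : gsupp (card_parity (~~ b)) u -> gpart b u = 0.
Proof.
move=> /gsuppP hu; apply/gcoefP => A; rewrite gcoef_gpart linear0.
case: ifPn => // /eqP PA; apply/eqP; apply: contraTT isT => /hu.
by rewrite /card_parity PA; case: b {PA hu}.
Qed.

Lemma gpartD u : gpart false u + gpart true u = u.
Proof.
apply/gcoefP => A; rewrite linearD /= !gcoef_gpart /card_parity.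
by case: (odd _); rewrite /= ?addr0 ?add0r.
Qed.

Lemma gpart_supp P b u : gsupp P u -> gsupp P (gpart b u).
Proof.
move=> /gsuppP hu; apply/gsuppP => A.
by rewrite gcoef_gpart; case: ifP => [_|]; rewrite ?eqxx //; apply: hu.
Qed.

Lemma even_central u v : even_supp u -> u * v = v * u.
Proof.
move=> hu; rewrite -(gpartD v) mulrDl mulrDr.
rewrite (gmulC_parity (gpart_parity _ _) hu) (gmulC_parity (gpart_parity _ _) hu).
by rewrite !andbF !expr0 !scale1r.
Qed.

Lemma odd_anticomm u v : odd_supp u -> odd_supp v -> u * v = - (v * u).
Proof. by move=> hu hv; rewrite (gmulC_parity hv hu) expr1 scaleN1r. Qed.

Lemma parityM b c u v : gsupp (card_parity b) u -> gsupp (card_parity c) v ->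
  gsupp (card_parity (b (+) c)) (u * v).
Proof.
apply: gsuppM => A B dAB /eqP hA /eqP hB; rewrite /card_parity.
by rewrite cardfsU (eqP (dAB : (A `&` B)%fset == fset0)) cardfs0 subn0 oddD hA hB.
Qed.

End GrassmannSupport.

Notation even_supp := (gsupp (card_parity false)).
Notation odd_supp := (gsupp (card_parity true)).

(** A first-order Taylor formula: z is central of square zero, so only terms linear in z survive,
    one for each occurrence of l. *)
Lemma tprod_shift (A : nzRingType) (t : nat -> A) (l : nat) (z : A) s :
    (forall i y, t i * y = y * t i) -> (forall y, z * y = y * z) -> z * z = 0 ->
  tprod (fun i => t i + (if i == l then z else 0)) s =
  tprod t s + (tprod t (rem l s) * z) *+ count_mem l s.
Proof.
move=> tC zC z2; elim: s => [|j s IH].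
  by rewrite /tprod !big_nil mulr0n addr0.
rewrite !tprod_cons IH /= mulrDl; case: (eqVneq j l) => [->|jl]; last first.
  by rewrite mul0r addr0 tprod_cons mulrDr mulrnAr mulrA add0n.
rewrite !mulrDr -!addrA; congr (_ + _).
have zRz R : z * (R * z) = 0 by rewrite zC -mulrA z2 mulr0.
rewrite !mulrnAr zRz mul0rn addr0.
rewrite add1n mulrS zC addrC; congr (_ + _).
have [ls|ls] := boolP (l \in s); last by rewrite (count_memPn ls) !mulr0n.
by rewrite (tprod_rem tC ls) !mulrA.
Qed.

(** * Substitutions that isolate a single form t^s xi_J *)

Section TopCoefficient.
Variables (k : fieldType) (G : grassmann_model k).
Implicit Types (u v : G) (A B : {fset nat}) (s J : seq nat).

Definition initial n : {fset nat} := [fset i in iota 0 n].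
Definition below n : pred {fset nat} := fun A => all (fun i => i < n)%N A.

Lemma initialE n i : (i \in initial n) = (i < n)%N.
Proof. by rewrite inE mem_iota. Qed.

Lemma below_initial n : below n (initial n).
Proof. by apply/allP => i; rewrite initialE. Qed.

Lemma initialS n : initial n.+1 = (initial n `|` [fset n])%fset.
Proof.
apply/fsetP => i; rewrite in_fsetU in_fset1 !initialE ltnS [LHS]leq_eqVlt.
by rewrite orbC.
Qed.

Lemma ginv_initial n : ginv (initial n) [fset n]%fset = 0%N.
Proof.
rewrite /ginv big_seq big1 // => i; rewrite initialE => lti.
by rewrite big_seq_fset1 ltnNge ltnW.
Qed.

(** Only e_A contributes to e_(A u {n}), so multiplying by e_n loses nothing away from n. This
    serves both for top coefficients and for detecting noncentral elements. *)
Lemma gcoef_mul1 n A u : n \notin A ->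
  gcoef G (A `|` [fset n])%fset (u * gbas G [fset n]%fset) =
  (-1) ^+ ginv A [fset n]%fset * gcoef G A u.
Proof.
move=> nA; have hu : gsupp xpredT u by apply/gsuppP.
move: u hu; apply: gsupp_ind => [|a B u _ IH]; first by rewrite mul0r !linear0 mulr0.
rewrite mulrDl -scalerAl !gcoefL IH mulrDr mulrCA; congr (_ * _ + _).
rewrite gbasM gcoefZ !gcoef_bas fdisjointX1.
have [nB|nB] := boolP (n \in B); rewrite /=.
  by rewrite !mul0r; case: eqVneq => [BA|]; rewrite ?mulr0 //; rewrite -BA nB in nA.
rewrite mul1r; case: (eqVneq B A) => [->|BA]; first by rewrite eqxx.
rewrite (_ : (_ == _) = false) ?mulr0 //; apply/negbTE.
apply: contraNneq BA => h; apply/eqP/fsetP => i.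
have := congr1 (fun C : {fset nat} => i \in C) h; rewrite !in_fsetU !in_fset1.
by case: (eqVneq i n) => [->|_]; rewrite ?(negPf nA) ?(negPf nB) // !orbF.
Qed.

Lemma gcoef_initialS n u :
  gcoef G (initial n.+1) (u * gbas G [fset n]%fset) = gcoef G (initial n) u.
Proof. by rewrite initialS gcoef_mul1 ?initialE ?ltnn // ginv_initial mul1r. Qed.

Definition gpair n : G := gbas G [fset n]%fset * gbas G [fset n.+1]%fset.

Lemma gcoef_initialSS n u :
  gcoef G (initial n.+2) (u * gpair n) = gcoef G (initial n) u.
Proof. by rewrite mulrA !gcoef_initialS. Qed.

Lemma gbas1_odd i : odd_supp (gbas G [fset i]%fset).
Proof. by apply: gsuppU; rewrite /card_parity cardfs1. Qed.

Lemma gpair_even n : even_supp (gpair n).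
Proof. exact: (parityM (gbas1_odd n) (gbas1_odd n.+1)). Qed.

Lemma gbas1_sqr i : gbas G [fset i]%fset * gbas G [fset i]%fset = 0.
Proof. by rewrite gbasM fdisjointX1 inE eqxx mul0r scale0r. Qed.

Lemma gpair_sqr n : gpair n * gpair n = 0.
Proof.
rewrite {1}/gpair -mulrA -(even_central _ (gpair_even n)) mulrA.
by rewrite /gpair mulrA gbas1_sqr !mul0r.
Qed.

Lemma belowW n m : (n <= m)%N -> subpred (below n) (below m).
Proof. by move=> nm A /allP h; apply/allP => i /h /leq_trans; apply. Qed.

Lemma belowM n u v : gsupp (below n) u -> gsupp (below n) v -> gsupp (below n) (u * v).
Proof.
apply: gsuppM => A B _ /allP hA /allP hB; apply/allP => i.
by rewrite in_fsetU => /orP[/hA|/hB].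
Qed.

Lemma gcoef_initial_below n m u : (n < m)%N -> gsupp (below n) u ->
  gcoef G (initial m) u = 0.
Proof.
move=> nm hu; apply/eqP; apply: contraTT isT => /(gsuppP _ _ hu) /allP /(_ n).
by rewrite initialE nm ltnn => /(_ isT).
Qed.

Lemma below1 n : gsupp (below n) (1 : G).
Proof. by rewrite -(gbas1 G); apply: gsuppU; apply/allP. Qed.

(* The substitution detecting t^s xi_J: xi_j is the generator numbered by the position
   of j in J, and each occurrence of i in s contributes to t_i a pair of fresh
   generators. *)
Fixpoint tval n s (i : nat) : G :=
  if s is l :: s' then
    tval n s' i + (if i == l then gpair (n + (size s').*2) else 0)
  else 0.

Definition xival J (j : nat) : G :=
  if j \in J then gbas G [fset index j J]%fset else 0.

Lemma tval_even n s i : even_supp (tval n s i).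
Proof.
elim: s => [|l s IH]; first exact: gsupp0.
apply: gsuppD IH _; case: ifP => _; [exact: gpair_even|exact: gsupp0].
Qed.

Lemma xival_odd J j : odd_supp (xival J j).
Proof. by rewrite /xival; case: ifP => _; [exact: gbas1_odd|exact: gsupp0]. Qed.

Lemma gbas1_below n i : (i < n)%N -> gsupp (below n) (gbas G [fset i]%fset).
Proof. by move=> lti; apply: gsuppU; apply/allP => j; rewrite inE => /eqP ->. Qed.

Lemma tval_below n s i : gsupp (below (n + (size s).*2)) (tval n s i).
Proof.
elim: s => [|l s IH] /=; first exact: gsupp0.
apply: gsuppD; first by apply: gsuppW IH; apply: belowW; rewrite leq_add2l leq_double.
case: ifP => _; last exact: gsupp0.
by apply: belowM; apply: gbas1_below; rewrite doubleS !addnS // ltnW.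
Qed.

Lemma xival_below n J j : (size J <= n)%N -> gsupp (below n) (xival J j).
Proof.
move=> h; rewrite /xival; case: ifP => jJ; last exact: gsupp0.
by apply/gbas1_below/(leq_trans _ h); rewrite index_mem.
Qed.

Lemma tprod_below n (t : nat -> G) s : (forall i, gsupp (below n) (t i)) ->
  gsupp (below n) (tprod t s).
Proof.
by move=> h; rewrite /tprod; elim/big_ind: _ => //; [exact: below1|exact: belowM].
Qed.

(** The form t^s' xi_J' is evaluated at the substitution attached to (s, J), and the coefficient is
    taken at the product of all the generators which that substitution uses. *)
Definition top_coef s J s' J' : k :=
  gcoef G (initial (size J + (size s).*2))
    (tprod (tval (size J) s) s' * xprod (xival J) J').

(** The head of s owns the last two generators. The Taylor term without its pair does not reach them
    and contributes 0; in the linear term the pair splits off. *)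
Lemma top_coefS l s J s' J' :
  top_coef (l :: s) J s' J' = (count_mem l s')%:R * top_coef s J (rem l s') J'.
Proof.
rewrite /top_coef /= tprod_shift; first last.
- exact: gpair_sqr.
- by move=> y; apply: even_central; apply: gpair_even.
- by move=> i y; apply: even_central; apply: tval_even.
set z := gpair _; set T := tprod _ _; set T' := tprod _ (rem _ _).
(* [xprod] and [tprod] unfold to the same product, so [tprod_below] applies to both. *)
have Xb : gsupp (below (size J + (size s).*2)) (xprod (xival J) J').
  by apply: tprod_below => i; apply: xival_below; rewrite leq_addr.
rewrite mulrDl linearD /= (@gcoef_initial_below (size J + (size s).*2)) ?add0r.
- rewrite mulrnAl -mulrA (even_central _ (gpair_even _)) mulrA.
  rewrite raddfMn /= mulr_natl; congr (_ *+ _).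
  by rewrite doubleS !addnS gcoef_initialSS.
- by rewrite ltn_add2l ltn_double.
- by apply: belowM Xb; apply: tprod_below => i; apply: tval_below.
Qed.

(** If J' has an index outside J the predicate is false everywhere, which encodes that the product
    is 0. *)
Lemma xprod_xival_supp J J' :
  gsupp (fun A => all (mem J) J' && all (fun i => i \in map (index^~ J) J') A)
    (xprod (xival J) J').
Proof.
elim: J' => [|j J' IH]; rewrite /xprod ?big_nil ?big_cons.
  by rewrite -(gbas1 G); apply: gsuppU; apply/allP.
rewrite [xival J j]/xival; case: ifP => jJ; last by rewrite mul0r gsupp0.
apply: (@gsuppM _ _ (pred1 [fset index j J]%fset)) IH; last first.
  by apply: gsuppU; apply: eqxx.
move=> A B _ /= /eqP -> /andP[hJ /allP hB]; rewrite jJ hJ; apply/allP => i.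
by rewrite in_fsetU in_fset1 inE => /orP[->//|/hB ->]; rewrite orbT.
Qed.

Lemma xprod_xival_neq0 J J' : uniq J ->
  gcoef G (initial (size J)) (xprod (xival J) J') != 0 -> perm_eq J J'.
Proof.
move=> uJ h; have /andP[/allP J'J /allP JJ'] := gsuppP _ _ (xprod_xival_supp J J') _ h.
have uJ' : uniq J'.
  apply/negPn/negP => nu; move: h; rewrite xprod_uniq ?linear0 ?eqxx //.
    by move=> i j; apply: odd_anticomm; apply: xival_odd.
  move=> i; rewrite /xival; case: ifP => _; rewrite ?mulr0 //; exact: gbas1_sqr.
apply: uniq_perm => // j; apply/idP/idP => [jJ|/J'J //].
have /mapP[j' j'J' eqi] : index j J \in map (index^~ J) J'.
  by apply: JJ'; rewrite initialE index_mem.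
have /= := congr1 (nth 0%N J) eqi; rewrite !nth_index //; first by move=> ->.
exact: J'J.
Qed.

Lemma xprod_xival_diag J : uniq J ->
  gcoef G (initial (size J)) (xprod (xival J) J) = 1.
Proof.
elim/last_ind: J => [_|J j IH].
  rewrite /xprod big_nil -(gbas1 G) gcoef_bas; case: eqP => // h; case: h.
  by apply/fsetP => i; rewrite !inE.
rewrite rcons_uniq => /andP[jJ uJ]; rewrite size_rcons /xprod -cats1 big_cat big_seq1 /=.
rewrite [X in _ * X]/xival mem_cat inE eqxx orbT index_cat (negPf jJ) /= eqxx addn0.
rewrite gcoef_initialS -[RHS](IH uJ); congr (gcoef G _ _); apply: eq_big_seq => i iJ.
by rewrite /xival mem_cat iJ /= index_cat iJ.
Qed.

Lemma top_coef_neq0 s J s' J' : uniq J -> top_coef s J s' J' != 0 ->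
  perm_eq s s' /\ perm_eq J J'.
Proof.
move=> uJ; elim: s s' => [|l s IH] s'.
  rewrite /top_coef /= addn0; case: s' => [|i s'].
    by rewrite /tprod big_nil mul1r => /(xprod_xival_neq0 uJ).
  by rewrite tprod_cons !mul0r linear0 eqxx.
rewrite top_coefS mulf_eq0 negb_or => /andP[c0 /IH[p pJ]]; split=> //.
have ls' : l \in s' by apply: contraNT c0 => /count_memPn ->.
by rewrite perm_sym (perm_trans (perm_to_rem ls')) // perm_cons perm_sym.
Qed.

(** The value is the product of the factorials of the multiplicities in s, nonzero in k as long as
    these stay below the characteristic. *)
Lemma top_coef_diag s J : uniq J ->
    (forall i n, (0 < n <= count_mem i s)%N -> n%:R != 0 :> k) ->
  top_coef s J s J != 0.
Proof.
move=> uJ; elim: s => [|l s IH] hs.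
  by rewrite /top_coef /= addn0 /tprod big_nil mul1r xprod_xival_diag ?oner_eq0.
rewrite top_coefS /= eqxx mulf_eq0 negb_or (hs l) ?IH /= ?eqxx //.
move=> i n /andP[n0 hn]; apply: (hs i); rewrite n0 /=.
exact: leq_trans hn (leq_addl _ _).
Qed.

End TopCoefficient.

(** * Monomials in Jordan products and commutators *)

Lemma seq2_ind (T : Type) (P : seq T -> Prop) :
    P [::] -> (forall a b s, ~~ odd (size s) -> P s -> P [:: a, b & s]) ->
  forall s, ~~ odd (size s) -> P s.
Proof.
move=> P0 PS s; have [n] := ubnP (size s); elim: n s => // n IH [|a [|b s]] //=.
rewrite !ltnS negbK => lt_s os; apply: PS => //; apply: IH => //.
exact: ltnW.
Qed.

Section JordanProduct.
Variable k : fieldType.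
Hypothesis two_neq0 : 2%:R != 0 :> k.
Local Notation half := (2%:R^-1 : k).

Section Def.
Variable A : algType k.

(** The factor 1/2 makes this agree with the ring product on commuting elements; in particular 1
    stays neutral. *)
Definition jmul (y z : A) : A := half *: (y * z + z * y).
Definition jprod (l : seq A) : A := foldr jmul 1 l.

Fixpoint brackets (x : nat -> A) (J : seq nat) : seq A :=
  if J is [:: a, b & J'] then half *: (x a * x b - x b * x a) :: brackets x J'
  else [::].

(* Lifts the even form t^s xi_J to the free algebra (J of even size); see
   [jmonomial_value]. *)
Definition jmonomial (x : nat -> A) (s J : seq nat) : A :=
  jprod (map x s ++ brackets x J).

Lemma half_double (y : A) : half *: (y + y) = y.
Proof. by rewrite -mulr2n -scaler_nat scalerA mulVf // scale1r. Qed.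

Lemma jmul_comm y z : y * z = z * y -> jmul y z = y * z.
Proof. by rewrite /jmul => <-; rewrite half_double. Qed.

End Def.

Lemma rmorph_jprod (A B : algType k) (phi : {lrmorphism A -> B}) (l : seq A) :
  phi (jprod l) = jprod (map phi l).
Proof.
elim: l => [|y l IH] /=; first exact: rmorph1.
by rewrite /jmul linearZ rmorphD !rmorphM /= -/(jprod l) IH.
Qed.

Lemma rmorph_brackets (A B : algType k) (phi : {lrmorphism A -> B})
    (x : nat -> A) (J : seq nat) :
  map phi (brackets x J) = brackets (phi \o x) J.
Proof.
have [n] := ubnP (size J); elim: n J => // n IH [|a [|b J]] //= lt_J.
by rewrite linearZ rmorphB !rmorphM /= IH // ltnW.
Qed.

Lemma rmorph_jmonomial (A B : algType k) (phi : {lrmorphism A -> B})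
    (x : nat -> A) (s J : seq nat) :
  phi (jmonomial x s J) = jmonomial (phi \o x) s J.
Proof. by rewrite /jmonomial rmorph_jprod map_cat rmorph_brackets -map_comp. Qed.

Section Value.
Variables (A : algType k) (t xi : nat -> A).
Hypothesis tC : forall i (y : A), t i * y = y * t i.
Hypothesis xiN : forall i j, xi i * xi j = - (xi j * xi i).
Local Notation x := (fun i => t i + xi i).

(** The central even parts cancel, while the anticommuting odd parts double. *)
Lemma bracket_value a b : half *: (x a * x b - x b * x a) = xi a * xi b.
Proof.
rewrite -[RHS]half_double; congr (_ *: _).
pose y := t a * t b + t a * xi b + xi a * t b.
have -> : x a * x b = y + xi a * xi b by rewrite mulrDl !mulrDr !addrA.
have -> : x b * x a = y - xi a * xi b.
  rewrite mulrDl !mulrDr (xiN b a) !addrA -(tC a (t b)) -(tC a (xi b)) (tC b (xi a)).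
  by congr (_ - _); rewrite /y -!addrA; congr (_ + _); rewrite addrC.
by rewrite opprB [xi a * xi b - y]addrC addrACA subrr add0r.
Qed.

Lemma xprod_pairC a b J : xi a * xi b * xprod xi J = xprod xi J * (xi a * xi b).
Proof.
elim: J => [|j J IH]; first by rewrite /xprod big_nil mul1r mulr1.
rewrite xprod_cons -[in RHS]mulrA -IH !mulrA; congr (_ * _).
by rewrite -mulrA xiN mulrN mulrA (xiN a j) mulNr opprK.
Qed.

Lemma jprod_brackets J : ~~ odd (size J) -> jprod (brackets x J) = xprod xi J.
Proof.
move: J; apply: seq2_ind => [|a b J oJ IH] /=; first by rewrite /xprod big_nil.
rewrite -/(jprod _) IH bracket_value jmul_comm; last exact: xprod_pairC.
by rewrite !xprod_cons mulrA.
Qed.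

Lemma xprod_evenC J j : ~~ odd (size J) -> xprod xi J * xi j = xi j * xprod xi J.
Proof.
move: J; apply: seq2_ind => [|a b J oJ IH]; first by rewrite /xprod big_nil mul1r mulr1.
rewrite !xprod_cons -!mulrA IH !mulrA; congr (_ * _).
by rewrite -mulrA (xiN b) mulrN mulrA (xiN a) mulNr opprK.
Qed.

(** Multiplying T + D by t_i + xi_i on either side gives the same terms except for xi_i D, whose
    sign changes; the symmetrised product loses it and keeps t_i T + d(t_i T). The factor xi_J is
    harmless because J has even size. *)
Lemma jmonomial_value s J : ~~ odd (size J) ->
  jmonomial x s J = (tprod t s + dtprod t xi s) * xprod xi J.
Proof.
move=> oJ; rewrite /jmonomial; elim: s => [|i s IH] /=.
  by rewrite jprod_brackets // dtprod_nil addr0 /tprod big_nil mul1r.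
rewrite -/(jprod _) IH /jmul dtprod_cons // tprod_cons.
have -> : (tprod t s + dtprod t xi s) * xprod xi J * (t i + xi i) =
    (t i * tprod t s + t i * dtprod t xi s + tprod t s * xi i - xi i * dtprod t xi s)
    * xprod xi J.
  rewrite mulrDr -(tC i) -!mulrA (xprod_evenC _ oJ) !mulrA -mulrDl; congr (_ * _).
  by rewrite mulrDl mulrDr (dtprod_xi tC xiN) !addrA.
have -> : (t i + xi i) * ((tprod t s + dtprod t xi s) * xprod xi J) =
    (t i * tprod t s + t i * dtprod t xi s + tprod t s * xi i + xi i * dtprod t xi s)
    * xprod xi J.
  by rewrite mulrA; congr (_ * _); rewrite mulrDl !mulrDr (tprodC tC) !addrA.
rewrite -mulrDl scalerAl; congr (_ * _); rewrite -[RHS]half_double; congr (_ *: _).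
set d := xi i * _; rewrite addrACA subrr addr0.
by rewrite (addrC (tprod t s * xi i)) !addrA.
Qed.

End Value.
End JordanProduct.

Lemma perm_nseq (T : eqType) n (x : T) s : (n <= count_mem x s)%N ->
  exists s', perm_eq s (nseq n x ++ s').
Proof.
elim: n s => [|n IH] s hn; first by exists s.
have xs : x \in s by rewrite -has_pred1 has_count (leq_trans _ hn).
have ps := perm_to_rem xs.
have [|s' ps'] := IH (rem x s).
  by move: hn; rewrite (permP ps) /= eqxx.
by exists s'; rewrite (perm_trans ps) //= perm_cons.
Qed.

(** * Values of Jordan monomials, weights and vanishing *)

Section Evaluation.
Variables (k : fieldType) (G : grassmann_model k).
Hypothesis two_neq0 : 2%:R != 0 :> k.
Variable F : free_model k.
Local Notation fmon := (jmonomial (fgen F)).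
Implicit Types (s J : seq nat).

Definition card_ge d : pred {fset nat} := fun A => (d <= #|` A|)%N.

Definition g0_supp m : pred {fset nat} := fun A => (A != fset0) && below m A.

Lemma card_geM d1 d2 (v w : G) : gsupp (card_ge d1) v -> gsupp (card_ge d2) w ->
  gsupp (card_ge (d1 + d2)) (v * w).
Proof.
apply: gsuppM => A B dAB hA hB; rewrite /card_ge.
rewrite cardfsU (eqP (dAB : (A `&` B)%fset == fset0)) cardfs0 subn0.
exact: leq_add.
Qed.

Lemma card_below m A : below m A -> (#|` A| <= m)%N.
Proof.
move=> /allP hA; rewrite -[X in (_ <= X)%N](size_iota 0).
by apply: uniq_leq_size => [|i /hA]; rewrite ?fset_uniq // mem_iota.
Qed.

Lemma gsupp_vanish m d (v : G) :
  gsupp (below m) v -> gsupp (card_ge d) v -> (m < d)%N -> v = 0.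
Proof.
move=> /gsuppP h1 /gsuppP h2 md; apply: gcoefP => A; rewrite linear0.
apply/eqP; apply: contraTT isT => h.
have := leq_trans (h2 _ h) (card_below (h1 _ h)).
by rewrite leqNgt md.
Qed.

Lemma sqr_odd (v : G) : odd_supp v -> v * v = 0.
Proof.
move=> hv; have /eqP := odd_anticomm hv hv.
rewrite -addr_eq0 -mulr2n -scaler_nat scaler_eq0 (negPf two_neq0) /=.
by move=> /eqP.
Qed.

(** Even elements commute, so raising to the power p is additive on them, and e_A^2 = 0 for nonempty
    A. *)
Lemma even_pchar p (v : G) : p \in [pchar k] ->
  gsupp (fun A => (A != fset0) && card_parity false A) v -> v ^+ p = 0.
Proof.
move=> pk hv; have pG : p \in [pchar G] := rmorph_pchar (in_alg G) pk.
have p2 : (1 < p)%N by rewrite prime_gt1 // (pcharf_prime pk).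
suff : v ^+ p = 0 /\ even_supp v by case.
move: v hv; apply: gsupp_ind => [|a A v /andP[A0 eA] [IH ev]].
  by rewrite expr0n -leqn0 leqNgt ltnW // gsupp0.
split; last by apply: gsuppL ev; apply: gsuppU.
have cAv : GRing.comm (a *: gbas G A) v.
  by apply: even_central; apply/gsuppZ/gsuppU.
rewrite -(pFrobenius_autE pG) pFrobenius_autD_comm // !pFrobenius_autE IH addr0.
rewrite -(subnKC p2) exprD expr2 -scalerAl -scalerAr gbasM.
by rewrite /fdisjoint fsetIid (negPf A0) mul0r scale0r !scaler0 mul0r.
Qed.

Variable u : nat -> G.

Definition evar i := gpart false (u i).
Definition ovar i := gpart true (u i).

Lemma evarC i y : evar i * y = y * evar i.
Proof. exact/even_central/gpart_parity. Qed.

Lemma ovarN i j : ovar i * ovar j = - (ovar j * ovar i).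
Proof. by apply: odd_anticomm; apply: gpart_parity. Qed.

Lemma ovar2 i : ovar i * ovar i = 0.
Proof. exact/sqr_odd/gpart_parity. Qed.

Lemma evar_ovar i : u i = evar i + ovar i.
Proof. by rewrite gpartD. Qed.

Local Notation T := (tprod evar).
Local Notation D := (dtprod evar ovar).
Local Notation Xi := (xprod ovar).

Lemma tprod_even s : even_supp (T s).
Proof.
rewrite /tprod; elim/big_ind: _ => [||i _]; last exact: gpart_parity.
  by rewrite -(gbas1 G) gsuppU // /card_parity cardfs0.
exact: parityM.
Qed.

Lemma dtprod_odd s : odd_supp (D s).
Proof.
apply: gsupp_sum => i _.
exact: (parityM (tprod_even _) (gpart_parity true (u i))).
Qed.

Lemma xprod_even J : ~~ odd (size J) -> even_supp (Xi J).
Proof.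
move: J; apply: seq2_ind => [|a b J oJ IH].
  by rewrite /xprod big_nil -(gbas1 G) gsuppU // /card_parity cardfs0.
rewrite !xprod_cons mulrA; apply: (@parityM _ _ false false) IH.
exact: (parityM (gpart_parity true (u a)) (gpart_parity true (u b))).
Qed.

Lemma subst_fmon s J : ~~ odd (size J) ->
  subst u (fmon s J) = (T s + D s) * Xi J.
Proof.
move=> oJ; rewrite rmorph_jmonomial.
rewrite -(jmonomial_value two_neq0 evarC ovarN s oJ).
have -> // : subst u \o fgen F = (fun i => evar i + ovar i).
by apply/funext => i; rewrite /= substX -evar_ovar.
Qed.

Lemma gpart_fmon s J : ~~ odd (size J) ->
  gpart true (subst u (fmon s J)) = D s * Xi J.
Proof.
move=> oJ; rewrite subst_fmon // mulrDl linearD /=.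
rewrite gpart_neq ?add0r; last exact: (parityM (tprod_even s) (xprod_even oJ)).
by rewrite gpart_id //; apply: (parityM (dtprod_odd s) (xprod_even oJ)).
Qed.

Lemma tprod_nseq n i : T (nseq n i) = evar i ^+ n.
Proof.
elim: n => [|n IH]; first by rewrite /tprod big_nil.
by rewrite /= tprod_cons IH exprS.
Qed.

Lemma dtprod_nseq n i : D (nseq n i) = (evar i ^+ n.-1 * ovar i) *+ n.
Proof.
elim: n => [|n IH]; first by rewrite dtprod_nil.
rewrite /= (dtprod_cons _ evarC) IH tprod_nseq mulrS; congr (_ + _).
by case: n {IH} => [|n]; rewrite ?mulr0n ?mulr0 // mulrnAr mulrA -exprS.
Qed.

Section Admissible.
Variable m : nat.
Hypothesis u_adm : forall i, gsupp (g0_supp m) (u i).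

Lemma evar_below i : gsupp (below m) (evar i).
Proof. by apply/gpart_supp/gsuppW/u_adm => A /andP[]. Qed.

Lemma ovar_below i : gsupp (below m) (ovar i).
Proof. by apply/gpart_supp/gsuppW/u_adm => A /andP[]. Qed.

Lemma evar_card i : gsupp (card_ge 2) (evar i).
Proof.
have h : gsupp (predI (g0_supp m) (card_parity false)) (evar i).
  by apply: gsuppI; [exact/gpart_supp/u_adm|exact: gpart_parity].
apply: gsuppW h => A /andP[/andP[A0 _]]; rewrite /card_parity /card_ge.
by rewrite -cardfs_eq0 in A0; case: #|` A| A0 => [|[|n]].
Qed.

Lemma ovar_card i : gsupp (card_ge 1) (ovar i).
Proof.
apply/gpart_supp/gsuppW/u_adm => A /andP[A0 _].
by rewrite /card_ge cardfs_gt0.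
Qed.

Lemma card_ge0 (v : G) : gsupp (card_ge 0) v.
Proof. by apply/gsuppP. Qed.

Lemma tprod_card s : gsupp (card_ge (size s).*2) (T s).
Proof.
elim: s => [|i s IH]; first exact: card_ge0.
rewrite tprod_cons; exact: card_geM (evar_card i) IH.
Qed.

Lemma xprod_card J : gsupp (card_ge (size J)) (Xi J).
Proof.
elim: J => [|i J IH]; first exact: card_ge0.
rewrite xprod_cons; exact: card_geM (ovar_card i) IH.
Qed.

Lemma dtprod_card s : gsupp (card_ge (size s).*2.-1) (D s).
Proof.
rewrite /dtprod big_seq; apply: gsupp_sum => i si.
have := card_geM (tprod_card (rem i s)) (ovar_card i).
by rewrite size_rem //; case: s si => // j s _; rewrite /= addn1.
Qed.

Lemma tprodX_below s : gsupp (below m) (T s).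
Proof. by apply: tprod_below => i; apply: evar_below. Qed.

Lemma xprodX_below J : gsupp (below m) (Xi J).
Proof. by apply: tprod_below => i; apply: ovar_below. Qed.

Lemma dtprod_below s : gsupp (below m) (D s).
Proof.
apply: gsupp_sum => i _.
by apply: belowM; [exact: tprodX_below|exact: ovar_below].
Qed.

(** The differential lowers the weight by one, so weight m + 2 is needed to kill the odd part as
    well; at weight m + 1 it may survive. *)
Lemma fmon_heavy s J : ~~ odd (size J) -> (m.+1 < (size s).*2 + size J)%N ->
  subst u (fmon s J) = 0.
Proof.
move=> oJ hm; rewrite subst_fmon // mulrDl.
rewrite (@gsupp_vanish m ((size s).*2 + size J) (T s * Xi J)) ?add0r; first last.
- exact: ltnW.
- exact: card_geM (tprod_card s) (xprod_card J).
- by apply: belowM; [exact: tprodX_below|exact: xprodX_below].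
apply: (@gsupp_vanish m ((size s).*2.-1 + size J)).
- by apply: belowM; [exact: dtprod_below|exact: xprodX_below].
- exact: card_geM (dtprod_card s) (xprod_card J).
by move: hm; case: (size s).*2 => [|n] //=; apply: ltnW.
Qed.

Lemma evar_exp p i : p \in [pchar k] -> evar i ^+ p = 0.
Proof.
move=> pk; apply: even_pchar pk _; apply: gsuppI (gpart_parity _ _).
by apply/gpart_supp/gsuppW/u_adm => A /andP[].
Qed.

(** Both t_i^p and d(t_i^p) = p t_i^(p-1) xi_i vanish, so a factor t_i^p kills the even and the odd
    part together. *)
Lemma fmon_power p i s J : p \in [pchar k] -> ~~ odd (size J) ->
  (p <= count_mem i s)%N -> subst u (fmon s J) = 0.
Proof.
move=> pk oJ cp; rewrite subst_fmon //.
have [s' ps] := perm_nseq cp; rewrite (tprod_perm evarC ps) (dtprod_perm _ evarC ps).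
have T0 : T (nseq p i) = 0 by rewrite tprod_nseq evar_exp.
rewrite tprod_cat (dtprod_cat _ evarC) T0 !mul0r addr0 add0r.
rewrite dtprod_nseq -mulr_natr.
by rewrite (pcharf0 (rmorph_pchar (in_alg G) pk)) mulr0 !mul0r.
Qed.

End Admissible.
End Evaluation.

(** The shapes of [w] and of [circ_prod] are restated over any ring and any entries, so that a
    substitution acts on the entries. *)
Definition wprod (A : nzRingType) (x : nat -> A) (q n : nat) : A :=
  \prod_(j < n) ((x j.*2 * x j.*2.+1 - x j.*2.+1 * x j.*2) *
    x j.*2 ^+ q * x j.*2.+1 ^+ q).

Lemma wprodS (A : nzRingType) (x : nat -> A) q n : wprod x q n.+1 =
  wprod x q n * ((x n.*2 * x n.*2.+1 - x n.*2.+1 * x n.*2) *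
    x n.*2 ^+ q * x n.*2.+1 ^+ q).
Proof. by rewrite /wprod big_ord_recr. Qed.

Fixpoint circp (A : nzRingType) (x : nat -> A) (n : nat) : A :=
  match n with
  | 0 => 0
  | 1 => x 0%N
  | n'.+1 => circp x n' * x n' + x n' * circp x n'
  end.

Lemma rmorph_wprod (A B : nzRingType) (phi : {rmorphism A -> B}) (x : nat -> A) q n :
  phi (wprod x q n) = wprod (phi \o x) q n.
Proof.
rewrite rmorph_prod; apply: eq_bigr => j _.
by rewrite !rmorphM rmorphB !rmorphM !rmorphXn.
Qed.

Lemma circpS (A : nzRingType) (x : nat -> A) n :
  circp x n.+2 = circp x n.+1 * x n.+1 + x n.+1 * circp x n.+1.
Proof. by []. Qed.

Lemma rmorph_circp (A B : nzRingType) (phi : {rmorphism A -> B}) (x : nat -> A) n :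
  phi (circp x n) = circp (phi \o x) n.
Proof.
case: n => [|n]; first by rewrite rmorph0.
by elim: n => [|n IH] //; rewrite !circpS rmorphD !rmorphM IH.
Qed.

Section SpecialValues.
Variables (k : fieldType) (G : grassmann_model k).
Hypothesis two_neq0 : 2%:R != 0 :> k.
Variable u : nat -> G.
Local Notation t := (evar u).
Local Notation xi := (ovar u).
Local Notation T := (tprod t).
Local Notation D := (dtprod t xi).
Local Notation Xi := (xprod xi).

(** Next to xi_i the odd part of x_i is killed by xi_i^2 = 0, so x_i acts as t_i. *)
Lemma ovar_expM i n : xi i * u i ^+ n = t i ^+ n * xi i.
Proof.
have xu : xi i * u i = t i * xi i.
  by rewrite [in LHS](evar_ovar u i) mulrDr ovar2 // addr0 evarC.
elim: n => [|n IH]; first by rewrite !expr0 mulr1 mul1r.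
by rewrite exprSr mulrA IH -mulrA xu mulrA -exprSr.
Qed.

Lemma evar_expC i n y : t i ^+ n * y = y * t i ^+ n.
Proof. by rewrite -tprod_nseq; apply/tprodC/evarC. Qed.

Lemma bracket_expM i j q :
  xi i * xi j * u i ^+ q * u j ^+ q = t i ^+ q * t j ^+ q * (xi i * xi j).
Proof.
have -> : xi i * xi j * u i ^+ q = t i ^+ q * (xi i * xi j).
  rewrite ovarN mulNr -mulrA ovar_expM mulrA -(evar_expC i q (xi j)) -mulrA.
  by rewrite mulrN.
by rewrite -!mulrA ovar_expM [xi i * _]mulrA -(evar_expC j q (xi i)) !mulrA.
Qed.

Lemma commutator_value i j : u i * u j - u j * u i = (xi i * xi j) *+ 2.
Proof.
rewrite -(bracket_value two_neq0 (evarC u) (ovarN u) i j) -!evar_ovar.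
by rewrite -scaler_nat scalerA divff // scale1r.
Qed.

(** The powers reduce to powers of the t's next to the commutators, and each commutator contributes
    a factor 2. The renaming [a] may be arbitrary. *)
Lemma wprod_value (a : nat -> nat) q n (J := map a (iota 0 n.*2)) :
  wprod (u \o a) q n = (T (flatten [seq nseq q j | j <- J]) * Xi J) *+ (2 ^ n).
Proof.
rewrite {}/J; elim: n => [|n IH].
  by rewrite /wprod big_ord0 /tprod /xprod !big_nil mulr1.
rewrite wprodS IH [X in X * _ * _]commutator_value.
have -> : iota 0 n.+1.*2 = iota 0 n.*2 ++ [:: n.*2; n.*2.+1].
  by rewrite doubleS -[n.*2.+2]addn2 iotaD.
rewrite !map_cat flatten_cat /= cats0.
set J := map a _; set c := xi _ * xi _.
have -> : Xi (J ++ [:: a n.*2; a n.*2.+1]) = Xi J * c.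
  by rewrite /xprod big_cat /= !big_cons big_nil mulr1.
rewrite [X in _ * X](_ : _ =
    (t (a n.*2) ^+ q * t (a n.*2.+1) ^+ q * c) *+ 2); last first.
  by rewrite !mulrnAl /= bracket_expM.
rewrite !tprod_cat !tprod_nseq expnSr mulrnA mulrnAl mulrnAr -!mulrnA.
rewrite mulnC; congr (_ *+ _); rewrite -!mulrA; congr (_ * _).
do 2![rewrite [Xi J * (_ * _)]mulrA -[Xi J * _]evar_expC -mulrA; congr (_ * _)].
Qed.
End SpecialValues.

(** * Spanning and reduction to normal monomials *)

Section Congruence.
Variables (k : fieldType) (G : grassmann_model k).
Hypothesis two_neq0 : 2%:R != 0 :> k.
Variable m : nat.
Variable F : free_model k.
Local Notation fmon := (jmonomial (fgen F)).
Implicit Types (f g : F) (s J : seq nat).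

Definition admissible (u : nat -> G) := forall i, gsupp (g0_supp m) (u i).

Definition vanishing f := forall u, admissible u -> subst u f = 0.

Lemma vanishing_eq f g : (forall u, admissible u -> subst u f = subst u g) ->
  vanishing (f - g).
Proof. by move=> h u hu; rewrite linearB /= h // subrr. Qed.

Lemma fmon_perm s s' J J' : ~~ odd (size J) -> perm_eq s s' -> perm_eq J J' ->
  exists c, vanishing (fmon s J - c *: fmon s' J').
Proof.
move=> oJ ps pJ; have [b hb] := xprod_perm pJ.
exists ((-1) ^+ b); apply: vanishing_eq => u _.
have oJ' : ~~ odd (size J') by rewrite -(perm_size pJ).
rewrite linearZ /= !subst_fmon // (hb _ _ (ovarN u)).
rewrite (tprod_perm (evarC u) ps) (dtprod_perm _ (evarC u) ps) mulr_signCA.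
by case: b {hb}; rewrite ?expr0 ?expr1 ?scale1r ?mul1r ?scaleN1r ?mulN1r.
Qed.

Lemma sum_rem_value (u : nat -> G) a j J : ~~ odd (size J) ->
  subst u (\sum_(l <- a) fmon (rem l a) [:: j, l & J]) =
  ovar u j * dtprod (evar u) (ovar u) a * xprod (ovar u) J.
Proof.
move=> oJ; rewrite raddf_sum /=.
transitivity (\sum_(l <- a) (ovar u j * (tprod (evar u) (rem l a) * ovar u l)
   - ovar u j * (dtprod (evar u) (ovar u) (rem l a) * ovar u l)) * xprod (ovar u) J).
  apply: eq_bigr => l _; rewrite subst_fmon ?negbK //= !xprod_cons.
  rewrite mulrDl mulrBl; congr (_ + _).
    by rewrite !mulrA (tprodC (evarC u)).
  by rewrite !mulrA -mulNr -mulNr (dtprod_xi (evarC u) (ovarN u)).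
rewrite -mulr_suml big_split /= sumrN -!mulr_sumr.
by rewrite (dtprod_closed (evarC u) (ovarN u)) mulr0 subr0.
Qed.

(* The sum comes from the odd part xi_i of x_i; its own odd part vanishes because the
   differential squares to zero. *)
Lemma var_fmon i s J : ~~ odd (size J) -> vanishing
  (fgen F i * fmon s J - (fmon (i :: s) J + \sum_(l <- s) fmon (rem l s) [:: i, l & J])).
Proof.
move=> oJ; apply: vanishing_eq => u _.
rewrite rmorphM linearD /= sum_rem_value // !subst_fmon // substX {1}evar_ovar.
rewrite (dtprod_cons _ (evarC u)) tprod_cons mulrA -mulrDl; congr (_ * _).
by rewrite mulrDl !mulrDr (tprodC (evarC u)) -!addrA; congr (_ + _); rewrite addrCA.
Qed.

(* The sum lifts the exact form d(t^a) xi_j xi_J up to sign. *)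
Lemma lie_fmon a j J : ~~ odd (size J) -> vanishing
  (\sum_(l <- a) fmon (rem l a) [:: j, l & J] -
   2%:R^-1 *: (fmon [:: j] J * fmon a [::] - fmon a [::] * fmon [:: j] J)).
Proof.
move=> oJ; apply: vanishing_eq => u _.
rewrite sum_rem_value // linearZ linearB !rmorphM /= !subst_fmon //.
set t := evar u; set x := ovar u; set D := dtprod _ _ _; set T := tprod _ a.
rewrite [xprod x [::]]/xprod big_nil mulr1 (dtprod_cons _ (evarC u)) dtprod_nil mulr0 addr0.
rewrite tprod_cons [tprod t [::]]/tprod big_nil mulr1 mul1r.
have -> : (t j + x j) * xprod x J * (T + D) = (t j + x j) * (T + D) * xprod x J.
  rewrite -!mulrA; congr (_ * _).
  exact/even_central/xprod_even.
have -> : (t j + x j) * (T + D) = (T + D) * (t j + x j) + (x j * D) *+ 2.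
  rewrite !mulrDl !mulrDr !(tprodC (evarC u) a) -[D * t j]evarC.
  rewrite (dtprod_xi (evarC u) (ovarN u)) -!addrA; congr (_ + _).
  by rewrite addrCA; congr (_ + (_ + _)); rewrite mulr2n addrA addNr add0r.
by rewrite mulrDl mulrA addrC addKr mulrnAl -scaler_nat scalerA mulVf // scale1r.
Qed.

(** Words grow by left multiplication by a generator, and [var_fmon] expands such a product into
    monomials again, modulo identities. *)
Lemma jmonomial_ind (P : F -> Prop) :
    (forall a f g, P f -> P g -> P (a *: f + g)) ->
    (forall f, vanishing f -> P f) ->
    (forall s J, ~~ odd (size J) -> P (fmon s J)) ->
  forall f, P f.
Proof.
move=> PL Pv PM f.
(* [S] is the least predicate with the three closure properties. The given [P] would not do: the
   induction has to be applied to the predicate sending g to [S (fgen F i * g)]. *)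
pose S f := forall Q : F -> Prop,
    (forall a f g, Q f -> Q g -> Q (a *: f + g)) ->
    (forall f, vanishing f -> Q f) ->
    (forall s J, ~~ odd (size J) -> Q (fmon s J)) -> Q f.
suff Sf : S f by apply: Sf.
have SL a g h : S g -> S h -> S (a *: g + h).
  by move=> hg hh Q QL Qv QM; exact: (QL _ _ _ (hg Q QL Qv QM) (hh Q QL Qv QM)).
have Sv g : vanishing g -> S g by move=> hg Q _ Qv _; apply: Qv.
have SM s J : ~~ odd (size J) -> S (fmon s J) by move=> oJ Q _ _ hQ; apply: hQ.
have S0 : S 0 by apply: Sv => u _; rewrite linear0.
have SD g h : S g -> S h -> S (g + h) by rewrite -{2}[g]scale1r; apply: SL.
elim/free_ind: f => [//|a g h|//|i g Sg]; first exact: SL.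
  by have -> : 1 = fmon [::] [::] by []; apply: SM.
apply: (Sg (fun g => S (fgen F i * g))) => [a f h hf hh|f vf|s J oJ].
- by rewrite mulrDr -scalerAr; apply: SL.
- by apply: Sv => u hu; rewrite rmorphM /= vf // mulr0.
rewrite -[fgen F i * _](subrK (fmon (i :: s) J + \sum_(l <- s) fmon (rem l s) [:: i, l & J])).
apply: (SD); first by apply: Sv; apply: var_fmon.
apply: (SD); first exact: SM.
by apply: big_ind => // l _; apply: SM; rewrite /= negbK.
Qed.

Lemma fconst_jprod (y : F) l : fconst y = 0 -> fconst (jprod (y :: l)) = 0.
Proof.
by move=> y0; rewrite /= /jmul linearZ rmorphD !rmorphM /= y0 mul0r mulr0 addr0 mulr0.
Qed.

Lemma fconst_brackets J y : y \in brackets (fgen F) J -> fconst y = 0.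
Proof.
have [n] := ubnP (size J); elim: n J => // n IH [|a [|b J]] //= lt_J.
rewrite inE => /orP[/eqP ->|/IH -> //]; last by rewrite ltnW.
by rewrite linearZ rmorphB !rmorphM /= !fconstX mul0r subrr mulr0.
Qed.

Lemma fconst_fmon s J : ~~ odd (size J) -> s ++ J != [::] ->
  fconst (fmon s J) = 0.
Proof.
case: s => [|i s] oJ nz; last exact/fconst_jprod/fconstX.
case: J oJ nz => // a [//|b J] /= _ _.
by apply: fconst_jprod; apply: (@fconst_brackets [:: a, b & J]); rewrite mem_head.
Qed.

End Congruence.

(** Left-normed and right-nested products agree after reversing the list, since the Jordan product
    is commutative; each of the n nontrivial products costs a factor 2. *)
Lemma circp_jprod (k : fieldType) (A : algType k) (x : nat -> A) n :
  2%:R != 0 :> k -> circp x n.+1 = 2%:R ^+ n *: jprod (rev (mkseq x n.+1)).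
Proof.
move=> two_neq0; elim: n => [|n IH].
  by rewrite expr0 scale1r /= jmul_comm ?mulr1 ?mul1r.
rewrite circpS IH [in RHS]mkseqS rev_rcons; set J := jprod (rev _).
have -> : jprod (x n.+1 :: rev (mkseq x n.+1)) = 2%:R^-1 *: (x n.+1 * J + J * x n.+1) by [].
by rewrite scalerA exprSr mulfK // -scalerAl -scalerAr -scalerDr addrC.
Qed.

(** * Reduction to normal monomials modulo U *)

Section Reduction.
Variables (k : fieldType) (G : grassmann_model k) (p m : nat).
Hypothesis two_neq0 : 2%:R != 0 :> k.
Hypothesis char_k : has_characteristic k p.
Variable F : free_model k.
Local Notation fmon := (jmonomial (fgen F)).
Local Notation vanishing := (vanishing G m).
Implicit Types (f g : F) (s J : seq nat).

(** Stands for [U_space] seen inside the unitary free algebra. Entries substituted into its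
    generators must have zero constant term, because they have to come from [free0]. *)
Variable U : F -> Prop.
Hypothesis UL : forall a f g, U f -> U g -> U (a *: f + g).
Hypothesis Uv : forall f, vanishing f -> U f.
Hypothesis Ulie : forall f g, fconst f = 0 -> fconst g = 0 -> U (f * g - g * f).
Hypothesis Uw : p != 0%N -> forall (a : nat -> nat) n, U (wprod (fun i => fgen F (a i)) p.-1 n.+1).
Hypothesis Ucirc : odd m -> forall x : nat -> F, (forall i, fconst (x i) = 0) ->
  U (circp x (m.+1)./2).

(* The variables whose multidegree is invertible in k; the first one, when there is
   one, is used to contract the de Rham complex. *)
Definition pivots (l : seq nat) : seq nat :=
  [seq i <- sort leq l | (count_mem i l)%:R != 0 :> k].

Lemma pivots_perm l l' : perm_eq l l' -> pivots l = pivots l'.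
Proof.
move=> pl; rewrite /pivots.
have -> : sort leq l = sort leq l'.
  by apply/(perm_sortP leq_total leq_trans anti_leq).
by apply: eq_filter => i; rewrite (permP pl).
Qed.

(** Sorting picks one monomial per form. Keeping the first pivot out of J selects a complement of
    the closed forms, weight at most m puts the differential in weight below m, where centrality
    sees it, and exponents below p avoid t_i^p = 0. *)
Definition normal (sJ : seq nat * seq nat) : bool :=
  let: (s, J) := sJ in
  [&& sorted leq s, sorted leq J, uniq J & ~~ odd (size J)] &&
  [&& pivots (s ++ J) != [::], head 0%N (pivots (s ++ J)) \notin J,
      ((size s).*2 + size J <= m)%N & all (fun i => (p == 0%N) || (count_mem i s < p)%N) s].

Definition comb (l : seq (k * (seq nat * seq nat))) : F :=
  \sum_(x <- l) x.1 *: fmon x.2.1 x.2.2.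

Definition good f := exists2 l, all normal (map snd l) & U (f - comb l).

Lemma U0 : U 0.
Proof. by apply: Uv => u _; rewrite linear0. Qed.

Lemma UZ a f : U f -> U (a *: f).
Proof. by move=> Uf; rewrite -[_ *: _]addr0; apply: UL U0. Qed.

Lemma UD f g : U f -> U g -> U (f + g).
Proof. by rewrite -{2}[f]scale1r; apply: UL. Qed.

Lemma goodL a f g : good f -> good g -> good (a *: f + g).
Proof.
case=> lf nf Uf [lg ng Ug].
exists ([seq (a * x.1, x.2) | x <- lf] ++ lg).
  by rewrite map_cat all_cat ng andbT -map_comp.
have Ea : \sum_(x <- lf) (a * x.1) *: fmon x.2.1 x.2.2 = a *: comb lf.
  by rewrite scaler_sumr; apply: eq_bigr => x _; rewrite scalerA.
have -> : comb ([seq (a * x.1, x.2) | x <- lf] ++ lg) = a *: comb lf + comb lg.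
  by rewrite {1}/comb big_cat big_map /= Ea.
by rewrite opprD addrACA -scalerBr; apply: UL.
Qed.

Lemma good_U f : U f -> good f.
Proof. by move=> Uf; exists [::] => //; rewrite /comb big_nil subr0. Qed.

Lemma good0 : good 0. Proof. exact/good_U/U0. Qed.

Lemma goodD f g : good f -> good g -> good (f + g).
Proof. by rewrite -{2}[f]scale1r; apply: goodL. Qed.

Lemma goodZ a f : good f -> good (a *: f).
Proof. by move=> gf; rewrite -[_ *: _]addr0; apply/goodL/good0. Qed.

Lemma good_vanishing f g : vanishing (f - g) -> good g -> good f.
Proof. by move=> v gg; rewrite -(subrK g f); apply: goodD gg; apply/good_U/Uv. Qed.

Lemma good_sum (I : Type) (r : seq I) (P : pred I) (h : I -> F) :
  (forall i, P i -> good (h i)) -> good (\sum_(i <- r | P i) h i).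
Proof. by move=> gh; elim/big_ind: _ => //; [exact: good0|exact: goodD]. Qed.

Lemma good_key s J : normal (s, J) -> good (fmon s J).
Proof.
move=> n; exists [:: (1, (s, J))]; first exact/andP.
by rewrite /comb big_seq1 scale1r subrr; apply: U0.
Qed.

Lemma good_perm s s' J J' : ~~ odd (size J) -> perm_eq s s' -> perm_eq J J' ->
  good (fmon s' J') -> good (fmon s J).
Proof.
move=> oJ ps pJ gs; have [c v] := fmon_perm G two_neq0 m F oJ ps pJ.
exact: good_vanishing v (goodZ c gs).
Qed.

Lemma pchar_k : p != 0%N -> p \in [pchar k].
Proof. by move=> p0; move: char_k; rewrite /has_characteristic (negPf p0). Qed.

Lemma vanishing_nuniq s J : ~~ odd (size J) -> ~~ uniq J -> vanishing (fmon s J).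
Proof.
move=> oJ nJ u hu; rewrite subst_fmon // xprod_uniq ?mulr0 //.
  exact: ovarN.
exact: ovar2.
Qed.

(** Variables and half commutators each account for weight 2, so the monomial has (m + 1)/2 Jordan
    factors and is, up to a power of 2, a substitution instance of the circle product. *)
Lemma U_circ s J : odd m -> ~~ odd (size J) -> ((size s).*2 + size J = m.+1)%N ->
  U (fmon s J).
Proof.
move=> om oJ sz.
have szb : size (brackets (fgen F) J) = (size J)./2.
  by move: J oJ {sz}; apply: seq2_ind => //= a b J oJ ->.
pose l := map (fgen F) s ++ brackets (fgen F) J.
have szl : size l = (m.+1)./2 by rewrite size_cat size_map szb; lia.
have l0 : forall y, y \in l -> fconst y = 0.
  move=> y; rewrite mem_cat => /orP[/mapP[i _ ->]|/fconst_brackets //].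
  exact: fconstX.
have [n En] : exists n, (m.+1)./2 = n.+1 by exists ((m.+1)./2.-1); lia.
pose x i := nth 0 (rev l) i.
have x0 i : fconst (x i) = 0.
  have [lti|lei] := ltnP i (size (rev l)); last by rewrite /x nth_default ?linear0.
  by apply: l0; rewrite -mem_rev mem_nth.
have := Ucirc om x0; rewrite En circp_jprod //.
have -> : mkseq x n.+1 = rev l by rewrite -En -szl -size_rev; apply: mkseq_nth.
rewrite revK => /(UZ (2%:R ^+ n)^-1).
by rewrite scalerA mulVf ?scale1r // expf_neq0.
Qed.

Lemma good_normal s J i l : ~~ odd (size J) -> pivots (s ++ J) = i :: l ->
  i \notin J -> good (fmon s J).
Proof.
move=> oJ piv iJ.
have [uJ|nJ] := boolP (uniq J); last exact/good_U/Uv/vanishing_nuniq.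
have [cs|] := boolP (all (fun i => (p == 0%N) || (count_mem i s < p)%N) s); last first.
  move=> /allPn[j _]; rewrite negb_or -leqNgt => /andP[p0 cj].
  apply/good_U/Uv => u hu.
  exact: (fmon_power two_neq0 F hu (pchar_k p0) oJ cj).
have [hm|hm] := leqP ((size s).*2 + size J) m; last first.
  have [hm1|hm1] := leqP ((size s).*2 + size J) m.+1; last first.
    by apply/good_U/Uv => u hu; apply: (fmon_heavy two_neq0 F hu).
  (* The weight is exactly m + 1, and it is even because J has even size; hence m is odd. *)
  by apply/good_U/U_circ => //; lia.
apply: (@good_perm _ (sort leq s) _ (sort leq J)) => //; try by rewrite perm_sym perm_sort.
apply: good_key; rewrite /normal !sort_uniq uJ size_sort oJ.
rewrite !sort_sorted ?leq_total //=; try exact: leq_total.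
have -> : pivots (sort leq s ++ sort leq J) = i :: l.
  by rewrite -piv; apply: pivots_perm; apply: perm_cat; rewrite perm_sort.
rewrite /= mem_sort iJ size_sort hm /=.
apply/allP => j; rewrite mem_sort => /(allP cs).
by rewrite count_sort.
Qed.

(** The contracting homotopy. The exact form d(t_i t^s) xi_j xi_J' lies in U up to sign and scalar.
    Its terms in xi_i give the multidegree of i times the monomial in question; all other terms have
    the same multidegree, hence the same pivot, and keep i out of their odd part. *)
Lemma good_pivot s J i l : ~~ odd (size J) -> pivots (s ++ J) = i :: l ->
  good (fmon s J).
Proof.
move=> oJ piv; have [iJ|iJ] := boolP (i \in J); last exact: good_normal piv iJ.
have [uJ|nJ] := boolP (uniq J); last exact/good_U/Uv/vanishing_nuniq.
(* J contains i and has even size, so a second entry j is available. *)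
have [j [J' pJ]] : exists j J', perm_eq J [:: j, i & J'].
  have pr := perm_to_rem iJ; have := perm_size pr.
  case E : (rem i J) => [|j J'] /= szJ; first by rewrite szJ in oJ.
  exists j, J'; apply: (perm_trans pr); rewrite E.
  by apply/permPl; apply: (perm_catCA [:: i] [:: j]).
have oJ' : ~~ odd (size J').
  by move: oJ; rewrite (perm_size pJ) /= negbK.
have uJ' : uniq [:: j, i & J'] by rewrite -(perm_uniq pJ).
apply: (good_perm oJ (perm_refl s) pJ).
(* Since i occurs once in J, this count is the whole multidegree of i, invertible because i is a
   pivot. *)
have ci : (count_mem i (i :: s))%:R != 0 :> k.
  have : i \in pivots (s ++ J) by rewrite piv mem_head.
  rewrite mem_filter => /andP[+ _]; rewrite count_cat (permP pJ) /=.
  move: uJ'; rewrite /= inE !negb_or => /and3P[/andP[/negPf ji _] iJ' _].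
  by rewrite ji eqxx (count_memPn iJ') addn1.
pose a := i :: s.
have gS : good (\sum_(h <- a) fmon (rem h a) [:: j, h & J']).
  apply: (good_vanishing (lie_fmon two_neq0 F _ _ oJ')).
  apply: goodZ; apply: good_U; apply: Ulie; apply: fconst_fmon => //.
have E : \sum_(h <- a) fmon (rem h a) [:: j, h & J'] =
    (count_mem i a)%:R *: fmon s [:: j, i & J'] +
    \sum_(h <- a | h != i) fmon (rem h a) [:: j, h & J'].
  rewrite (bigID (fun h => h == i)) /=; congr (_ + _).
  rewrite (eq_bigr (fun=> fmon s [:: j, i & J'])); last first.
    by move=> h /eqP ->; rewrite /a /= eqxx.
  by rewrite big_const_seq iter_addr_0 scaler_nat.
have gR : good (\sum_(h <- a | h != i) fmon (rem h a) [:: j, h & J']).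
  rewrite big_seq_cond; apply: good_sum => h /andP[ha hi].
  apply: (@good_normal _ _ i l) => /=; first by rewrite negbK.
    rewrite -piv; apply: pivots_perm; apply/permP => P.
    have H : (P i + count P s = P h + count P (rem h a))%N.
      exact: permP (perm_to_rem ha) P.
    rewrite !count_cat (permP pJ P) /= addnCA [RHS]addnCA; congr (_ + _)%N.
    by rewrite !addnA [(_ + P h)%N]addnC -H (addnC (P i : nat)).
  move: uJ'; rewrite /= !inE !negb_or eq_sym => /and3P[/andP[-> _] -> _].
  by rewrite eq_sym hi.
have : good ((count_mem i a)%:R *: fmon s [:: j, i & J']).
  by move: (goodL (-1) gR gS); rewrite E scaleN1r addrCA addNr addr0.
move=> /(goodZ ((count_mem i a)%:R)^-1).
by rewrite scalerA mulVf // scale1r.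
Qed.

Lemma count_blocks q i J :
  count_mem i (flatten [seq nseq q j | j <- J]) = (q * count_mem i J)%N.
Proof.
elim: J => [|j J IH] /=; first by rewrite muln0.
by rewrite count_cat count_nseq IH mulnDr mulnC.
Qed.

(** The odd part d(t^s) xi_J vanishes: every index of s already lies in J, so each term repeats some
    xi_l. What remains is the value of the word w up to a power of 2. *)
Lemma U_w J : p != 0%N -> uniq J -> ~~ odd (size J) -> J != [::] ->
  U (fmon (flatten [seq nseq p.-1 j | j <- J]) J).
Proof.
move=> p0 uJ oJ nJ; set s := flatten _.
have [n szJ] : exists n, size J = n.+1.*2.
  by case: (J) oJ nJ => [|a [|b J']] //= oJ' _; exists (size J')./2; lia.
have Jm : map (nth 0%N J) (iota 0 n.+1.*2) = J by rewrite -szJ; apply: mkseq_nth.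
rewrite -(subrK ((2%:R ^+ n.+1)^-1 *: wprod (fun i => fgen F (nth 0%N J i)) p.-1 n.+1) (fmon _ _)).
apply: UD; last by apply/UZ/Uw.
apply/Uv/vanishing_eq => u _; rewrite linearZ /= rmorph_wprod subst_fmon //.
have -> : subst u \o (fun i => fgen F (nth 0%N J i)) = u \o nth 0%N J.
  by apply/funext => i; rewrite /= substX.
rewrite wprod_value // Jm -/s -scaler_nat scalerA natrX mulVf ?expf_neq0 //.
rewrite scale1r mulrDl [dtprod _ _ s]/dtprod mulr_suml big_seq big1 ?addr0 // => l ls.
have lJ : l \in J.
  move: ls; rewrite -has_pred1 has_count count_blocks muln_gt0 => /andP[_].
  by rewrite -has_count has_pred1.
rewrite -mulrA -xprod_cons xprod_uniq ?mulr0 //=; last by rewrite lJ.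
  exact: ovarN.
exact: ovar2.
Qed.

(** Without a pivot every multidegree is zero in k, which is impossible in characteristic 0.
    Otherwise, unless the monomial vanishes, exponents in s are below p and indices occur at most
    once in J; divisibility by p then forces exponent p - 1 in s and presence in J, the case of
    [U_w]. *)
Lemma good_fmon s J : ~~ odd (size J) -> s ++ J != [::] -> good (fmon s J).
Proof.
move=> oJ nz; case piv : (pivots (s ++ J)) => [|i l]; last exact: good_pivot piv.
have [uJ|nJ] := boolP (uniq J); last exact/good_U/Uv/vanishing_nuniq.
have cnt i : i \in s ++ J -> (count_mem i (s ++ J))%:R = 0 :> k.
  move=> hi; apply/eqP; apply: contraFT (in_nil i) => ci.
  by rewrite -piv mem_filter ci mem_sort.
have p0 : p != 0%N.
  apply/negP => p0; case E : (s ++ J) nz => [|i l] // _.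
  have /pcharf0P c0 : [pchar k] =i pred0.
    by move: char_k; rewrite /has_characteristic p0.
  by have := cnt i; rewrite E mem_head => /(_ isT) /eqP; rewrite c0 /= eqxx.
have pk := pchar_k p0.
have pdvd i : i \in s ++ J -> (p %| count_mem i s + (i \in J))%N.
  move=> hi; rewrite -(count_uniq_mem _ uJ) -count_cat (dvdn_pcharf pk).
  by rewrite (cnt _ hi) eqxx.
have [cs|] := boolP (all (fun i => (count_mem i s < p)%N) s); last first.
  move=> /allPn[j _]; rewrite -leqNgt => cj.
  apply/good_U/Uv => u hu.
  exact: (fmon_power two_neq0 F hu pk oJ cj).
have sJ i : i \in s -> i \in J.
  move=> si; have := pdvd i; rewrite mem_cat si => /(_ isT).
  case: (i \in J) => //; rewrite addn0 => /dvdn_leq.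
  by rewrite -has_count has_pred1 => /(_ si); rewrite leqNgt (allP cs _ si).
have nJ : J != [::].
  apply: contraNneq nz => J0; case: (s) sJ => [|i s'] h; rewrite J0 // in h *.
  by have := h i (mem_head _ _).
apply: (good_perm oJ _ (perm_refl J)); last exact/good_U/(U_w p0 uJ oJ nJ).
apply/allP => i _ /=; rewrite count_blocks (count_uniq_mem _ uJ).
have [iJ|iJ] := boolP (i \in J); last first.
  by rewrite muln0; apply/eqP/count_memPn; apply: contraNN iJ; apply: sJ.
have := pdvd i; rewrite mem_cat iJ orbT => /(_ isT) /dvdn_leq.
rewrite addn1 muln1 => /(_ isT) h1.
have [si|/count_memPn si] := boolP (i \in s).
  by rewrite -eqSS prednK ?lt0n // eqn_leq (allP cs _ si).
by move: h1; rewrite si leqNgt (prime_gt1 (pcharf_prime pk)).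

Qed.

(** Evaluating all variables at 0 returns the constant term. *)
Lemma vanishing_fconst f : vanishing f -> fconst f = 0.
Proof.
have E : subst (fun=> 0 : G) f = (fconst f)%:A.
  elim/free_ind: f => [|a f g hf hg||i f _]; rewrite ?linear0 ?scale0r //.
  - by rewrite !linearP /= hf hg scalerDl scalerA.
  - by rewrite !rmorph1 scale1r.
  by rewrite !rmorphM /= substX fconstX !mul0r scale0r.
move=> /(_ (fun=> 0) (fun=> gsupp0 _ _)) /eqP.
by rewrite E scaler_eq0 oner_eq0 orbF => /eqP.
Qed.

(** The induction runs through the unitary algebra, so it is carried out on f minus its constant
    term. *)
Lemma all_good f : fconst f = 0 -> good f.
Proof.
move=> f0; suff : good (f - fconst f *: 1) by rewrite f0 scale0r subr0.
move: f {f0}; apply: (@jmonomial_ind k G two_neq0 m F) => [a f g hf hg|f vf|s J oJ].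
- rewrite linearP /= scalerDl -scalerA opprD addrACA -scalerBr; exact: goodL.
- by rewrite (vanishing_fconst vf) scale0r subr0; apply/good_U/Uv.
have [E|nz] := eqVneq (s ++ J) [::]; last first.
  by rewrite fconst_fmon // scale0r subr0; apply: good_fmon.
move: oJ E; case: s => [|//]; case: J => [|//] _ _.
have -> : fmon [::] [::] = 1 by [].
by rewrite rmorph1 scale1r subrr; apply: good0.
Qed.

End Reduction.

(** * Independence of the normal monomials *)

Section Independence.
Variables (k : fieldType) (G : grassmann_model k) (p m : nat).
Hypothesis two_neq0 : 2%:R != 0 :> k.
Hypothesis char_k : has_characteristic k p.
Variable F : free_model k.
Local Notation fmon := (jmonomial (fgen F)).
Local Notation normal := (normal k p m).
Implicit Types (f g : F) (s J : seq nat).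

Definition central_valued f := forall u, @admissible k G m u ->
  gsupp (card_ge m) (gpart true (subst u f)).

Lemma central_valuedL a f g : central_valued f -> central_valued g ->
  central_valued (a *: f + g).
Proof. by move=> hf hg u hu; rewrite !linearP /=; apply: gsuppL; [exact: hf|exact: hg]. Qed.

Section Functional.
Variables s0 J0 : seq nat.
Hypothesis n0 : normal (s0, J0).
Let i0 := head 0%N (pivots k (s0 ++ J0)).
(* t^ts xi_tJ is a term of d(t^s0 xi_J0), and of the differential of no other normal
   monomial. *)
Let ts := rem i0 s0.
Let tJ := i0 :: J0.
Let N := (size tJ + (size ts).*2)%N.
Let u i : G := tval G (size tJ) ts i + xival G tJ i.

Lemma pivot_mem : i0 \in s0.
Proof.
case/andP: n0 => _ /and4P[pv iJ _ _].
have : i0 \in pivots k (s0 ++ J0).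
  by rewrite /i0; case: (pivots _ _) pv => // i l _; apply: mem_head.
by rewrite mem_filter mem_sort mem_cat (negPf iJ) orbF => /andP[].
Qed.

(** The chosen term of the differential has weight one less than a normal monomial, so a central
    value cannot have it in its odd part. *)
Lemma N_lt : (N < m)%N.
Proof.
case/andP: n0 => _ /and4P[_ _ hm _]; apply: leq_trans hm.
have := pivot_mem; rewrite /N /tJ /ts => /size_rem ->.
have : (0 < size s0)%N by case: (s0) pivot_mem.
by move: (size s0) => /=; lia.
Qed.

Lemma u_admissible : @admissible k G m u.
Proof.
move=> i; apply: gsuppI; last first.
  apply: (gsuppW (belowW (ltnW N_lt))); apply: gsuppD.
    exact: tval_below.
  by apply: xival_below; rewrite leq_addr.
have g1 j : gsupp (fun A => A != fset0) (gbas G [fset j]%fset).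
  by apply: gsuppU; apply/fset0Pn; exists j; rewrite inE.
rewrite /u; apply: gsuppD; last by rewrite /xival; case: ifP => _; rewrite ?gsupp0.
elim: ts => [|l s IH] /=; first exact: gsupp0.
apply: gsuppD IH _; case: ifP => _; last exact: gsupp0.
by apply: gsuppM (g1 _) (g1 _) => A B _ A0 _; rewrite fsetU_eq0 negb_and A0.
Qed.

Lemma evar_u : evar u = tval G (size tJ) ts.
Proof.
apply/funext => i; rewrite /evar linearD /= (gpart_id (tval_even _ _ _ _)).
by rewrite gpart_neq ?addr0 //; apply: xival_odd.
Qed.

Lemma ovar_u : ovar u = xival G tJ.
Proof.
apply/funext => i; rewrite /ovar linearD /= (gpart_id (xival_odd _ _ _)).
by rewrite gpart_neq ?add0r //; apply: tval_even.
Qed.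

Definition functional f : k := gcoef G (initial N) (gpart true (subst u f)).

Fact functional_linear : scalar functional.
Proof. by move=> a f g; rewrite /functional !linearP. Qed.
HB.instance Definition _ := GRing.isLinear.Build k F k *%R functional
  functional_linear.

Lemma functional_central f : central_valued f -> functional f = 0.
Proof.
move=> /(_ _ u_admissible) /gsuppP h; apply/eqP; apply: contraTT isT => /h.
rewrite /card_ge leqNgt (leq_ltn_trans _ N_lt) //.
exact/card_below/below_initial.
Qed.

Lemma functional_fmon s J : ~~ odd (size J) ->
  functional (fmon s J) = \sum_(i <- s) top_coef G ts tJ (rem i s) (i :: J).
Proof.
move=> oJ; rewrite /functional gpart_fmon // evar_u ovar_u /dtprod mulr_suml.
rewrite raddf_sum /=; apply: eq_bigr => i _; congr (gcoef G _ _).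
by rewrite -mulrA -xprod_cons.
Qed.

Lemma tJ_uniq : uniq tJ.
Proof.
by case/andP: n0 => /and4P[_ _ uJ _] /and4P[_ iJ _ _]; rewrite /= iJ.
Qed.

(** A nonzero value forces equal multidegrees, hence equal first pivots. As i0 then avoids J, the
    differentiated index must be i0, and removing it recovers both (s, J) and (s0, J0). *)
Lemma functional_other s J : normal (s, J) -> (s, J) != (s0, J0) ->
  functional (fmon s J) = 0.
Proof.
move=> n; have /andP[/and4P[ss sJ uJ oJ] /and4P[pv iJ _ _]] := n.
have /andP[/and4P[ss0 sJ0 _ _] _] := n0.
move=> ne; rewrite functional_fmon // big_seq big1 // => i si.
apply: contraNeq ne => /(top_coef_neq0 tJ_uniq) [ps pJ].
have psJ : perm_eq (s0 ++ J0) (s ++ J).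
  have h1 := perm_to_rem pivot_mem; have h2 := perm_to_rem si.
  apply/permP => P; rewrite !count_cat (permP h1) (permP h2) /= -/i0 -/ts.
  rewrite (permP ps P) addnAC [RHS]addnAC; congr (_ + _)%N.
  exact: (permP pJ P).
have i0i : i0 = i.
  have : i0 \in i :: J by rewrite -(perm_mem pJ) mem_head.
  rewrite inE => /orP[/eqP //|]; rewrite /i0 (pivots_perm k psJ).
  by rewrite (negPf iJ).
have p1 : perm_eq s0 s.
  apply: (perm_trans (perm_to_rem pivot_mem)); rewrite perm_sym.
  by apply: (perm_trans (perm_to_rem si)); rewrite -i0i perm_cons perm_sym -/ts [X in rem X s]i0i.
have p2 : perm_eq J0 J by move: pJ; rewrite /tJ i0i perm_cons.
rewrite xpair_eqE (sorted_eq leq_trans anti_leq ss ss0) ?(perm_sym s) //.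
by rewrite (sorted_eq leq_trans anti_leq sJ sJ0) ?eqxx // perm_sym.
Qed.

(** Only differentiation with respect to i0 contributes. It yields the multidegree of the pivot,
    invertible by choice, times a product of factorials of numbers below p (any factorials in
    characteristic 0). *)
Lemma functional_diag : functional (fmon s0 J0) != 0.
Proof.
have /andP[/and4P[_ _ _ oJ] /and4P[pv iJ _ cs]] := n0.
rewrite functional_fmon // (bigID (pred1 i0)) /= [X in _ + X]big1_seq ?addr0; last first.
  move=> i /andP[ne si]; apply: contraNeq ne => /(top_coef_neq0 tJ_uniq) [_ pJ].
  have : i \in tJ by rewrite (perm_mem pJ) mem_head.
  have : i0 \in i :: J0 by rewrite -(perm_mem pJ) mem_head.
  by rewrite inE (negPf iJ) orbF eq_sym.
rewrite (eq_bigr (fun=> top_coef G ts tJ ts tJ)); last by move=> i /eqP ->.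
rewrite big_const_seq iter_addr_0 -mulr_natl mulf_neq0 //.
  have : i0 \in pivots k (s0 ++ J0).
    by rewrite /i0; case: (pivots _ _) pv => // i l _; apply: mem_head.
  by rewrite mem_filter count_cat (count_memPn iJ) addn0 => /andP[].
apply: top_coef_diag tJ_uniq _ => i n /andP[n_gt0 hn].
have {}hn : (n <= count_mem i s0)%N.
  by apply: leq_trans hn _; rewrite (permP (perm_to_rem pivot_mem)) leq_addl.
have is0 : i \in s0 by rewrite -has_pred1 has_count (leq_trans n_gt0).
have := allP cs _ is0; move: char_k; rewrite /has_characteristic.
case: eqP => [_ /pcharf0P -> _|_ pk /= h]; first by rewrite -lt0n.
by rewrite -(dvdn_pcharf pk) gtnNdvd // (leq_ltn_trans hn h).
Qed.

End Functional.

(** Keys may repeat in l: all occurrences of the first key are collected, [functional] shows that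
    their coefficients sum to 0, and the shorter list of remaining terms is treated by induction. *)
Lemma comb_eq0 l : all normal (map snd l) -> central_valued (comb F l) -> comb F l = 0.
Proof.
have [n] := ubnP (size l); elim: n l => // n IH l.
case: l => [|[c [s J]] l'] lt_l nl; first by rewrite /comb big_nil.
set l := (_ :: l') in lt_l nl * => cl.
have nsJ : normal (s, J) by case/andP: nl.
pose l2 := [seq x <- l | x.2 != (s, J)].
have E : comb F l = (\sum_(x <- l | x.2 == (s, J)) x.1) *: fmon s J + comb F l2.
  rewrite /comb big_filter (bigID (fun x => x.2 == (s, J))) /= scaler_suml.
  by congr (_ + _); apply: eq_bigr => x /eqP ->.
have n2 : all normal (map snd l2).
  by apply/allP => x /mapP[y]; rewrite mem_filter => /andP[_ yl] ->; apply: (allP nl); apply: map_f.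
have c0 : \sum_(x <- l | x.2 == (s, J)) x.1 = 0.
  have := functional_central nsJ cl; rewrite E linearP /=.
  rewrite [functional _ _ (comb F l2)](_ : _ = 0) ?addr0; last first.
    rewrite /comb raddf_sum /= big_filter big1_seq // => x /andP[xne xl].
    rewrite linearZ /= functional_other ?mulr0 -?surjective_pairing //.
    by apply: (allP nl); apply: map_f.
  by move/eqP; rewrite mulf_eq0 (negPf (functional_diag nsJ)) orbF => /eqP.
have El : comb F l = comb F l2 by rewrite E c0 scale0r add0r.
rewrite El; apply: IH => //; last by rewrite -El.
rewrite /l2 /= eqxx /= size_filter; apply: leq_ltn_trans (count_size _ _) _.
by move: lt_l; rewrite ltnS.
Qed.

End Independence.

(** * Central values *)

Section ModelCentral.
Variables (k : fieldType) (G : grassmann_model k) (F : free_model k).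
Implicit Types (f g : F).

Lemma g0_suppM m (u v : G) :
  gsupp (g0_supp m) u -> gsupp (g0_supp m) v -> gsupp (g0_supp m) (u * v).
Proof.
apply: gsuppM => A B _ /andP[A0 /allP hA] /andP[_ /allP hB].
rewrite /g0_supp fsetU_eq0 negb_and A0; apply/allP => i.
by rewrite in_fsetU => /orP[/hA|/hB].
Qed.

Lemma gbas1_g0_supp m i : (i < m)%N -> gsupp (g0_supp m) (gbas G [fset i]%fset).
Proof.
move=> im; apply: gsuppU; apply/andP; split.
  by apply/fset0Pn; exists i; rewrite inE.
by apply/allP => j; rewrite inE => /eqP ->.
Qed.

(** Induction on the size of A, splitting off one generator. It shows that the support condition
    describes the nonunitary algebra generated by the first m generators. *)
Lemma g0_supp_ind m (C : G -> Prop) :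
    C 0 -> (forall a u v, C u -> C v -> C (a *: u + v)) ->
    (forall u v, C u -> C v -> C (u * v)) ->
    (forall i, (i < m)%N -> C (gbas G [fset i]%fset)) ->
  forall u, gsupp (g0_supp m) u -> C u.
Proof.
move=> C0 CL CM Cgen u; move: u; apply: gsupp_ind => [//|a A v /andP[A0 Am] Cv].
apply: (CL) => //; have [n] := ubnP #|` A|; elim: n A A0 Am => // n IH A A0 Am cA.
have /fset0Pn[i iA] := A0.
have Ci : C (gbas G [fset i]%fset) by apply: Cgen; apply: (allP Am).
have [E|B0] := eqVneq (A `\ i)%fset fset0.
  by rewrite -(fsetD1K iA) E fsetU0.
have C1 : C (gbas G (A `\ i)%fset).
  apply: (IH) => //; last by rewrite (cardfsD1 i) iA in cA.
  by apply/allP => j; rewrite in_fsetD1 => /andP[_ /(allP Am)].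
have -> : gbas G A = (-1) ^+ ginv [fset i]%fset (A `\ i)%fset *:
    (gbas G [fset i]%fset * gbas G (A `\ i)%fset) + 0.
  rewrite addr0 gbasM (_ : [disjoint _ & _]%fset) ?fdisjoint1X ?inE ?eqxx //.
  rewrite mul1r scalerA -expr2 -exprM mulnC exprM sqrrN expr1n expr1n scale1r.
  by rewrite fsetD1K.
by apply: (CL) => //; apply: CM.
Qed.

Lemma subst_g0_supp m (u : nat -> G) f : admissible m u -> fconst f = 0 ->
  gsupp (g0_supp m) (subst u f).
Proof.
move=> hu f0; suff : gsupp (g0_supp m) (subst u f - fconst f *: 1).
  by rewrite f0 scale0r subr0.
elim/free_ind: f {f0} => [|a f g hf hg||i f hf].
- by rewrite !linear0 scale0r subr0 gsupp0.
- by rewrite !linearP /= scalerDl -scalerA opprD addrACA -scalerBr gsuppL.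
- by rewrite !rmorph1 scale1r subrr gsupp0.
rewrite !rmorphM /= fconstX mul0r scale0r subr0 substX.
rewrite -(subrK (fconst f *: 1) (subst u f)) mulrDr addrC -scalerAr mulr1.
exact/gsuppL/(g0_suppM (hu i) hf).
Qed.

Hypothesis two_neq0 : 2%:R != 0 :> k.

(** If the odd part v has a term e_A with fewer than m factors, some e_i with i outside A satisfies
    v e_i <> 0; yet v anticommutes with e_i, so commutation would give 2 v e_i = 0. Conversely, v in
    degree m is annihilated by all of G_0(m). *)
Lemma g0_centerP m (z : G) : gsupp (g0_supp m) z ->
  (forall x, gsupp (g0_supp m) x -> z * x = x * z) <->
  gsupp (card_ge m) (gpart true z).
Proof.
move=> hz; set v := gpart true z.
have vodd : odd_supp v by apply: gpart_parity.
have vb : gsupp (below m) v by apply/gpart_supp/gsuppW/hz => A /andP[].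
split=> [zC|hv].
  apply/gsuppP => A hA; rewrite /card_ge leqNgt; apply/negP => cA.
  have [i im iA] : exists2 i, (i < m)%N & i \notin A.
    apply: contrapT => h; move: cA; apply/negP; rewrite -leqNgt -[X in (X <= _)%N](size_iota 0).
    apply: uniq_leq_size (iota_uniq _ _) _ => i; rewrite mem_iota /= add0n => im.
    by apply/negPn/negP => iA; apply: h; exists i.
  have := zC _ (gbas1_g0_supp im).
  set e := gbas G _; rewrite -(gpartD z) -/v mulrDl mulrDr.
  rewrite (even_central e (gpart_parity false z)) => /addrI.
  rewrite -[e * v]opprK -(odd_anticomm vodd (gbas1_odd _ i)) => /eqP.
  rewrite -addr_eq0 -mulr2n -scaler_nat scaler_eq0 (negPf two_neq0) /= => /eqP ve.
  have := gcoef_mul1 v iA; rewrite -/e ve linear0 => /esym/eqP.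
  by rewrite mulf_eq0 signr_eq0 (negPf hA).
move=> x hx.
have x1 : gsupp (card_ge 1) x.
  by apply: gsuppW hx => A /andP[A0 _]; rewrite /card_ge cardfs_gt0.
have xb : gsupp (below m) x by apply: gsuppW hx => A /andP[].
have vx : v * x = 0.
  by apply: (gsupp_vanish (belowM vb xb) (card_geM hv x1)); rewrite addn1.
have xv : x * v = 0.
  by apply: (gsupp_vanish (belowM xb vb) (card_geM x1 hv)); rewrite add1n.
rewrite -(gpartD z) -/v mulrDl mulrDr vx xv !addr0.
exact/even_central/gpart_parity.
Qed.

Lemma central_valued_diff m f g h : central_valued G m f -> central_valued G m h ->
  h = f - g -> central_valued G m g.
Proof.
move=> hf hh E; have -> : g = (-1) *: h + f by rewrite E scaleN1r opprB subrK.
exact: central_valuedL.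
Qed.

Lemma central_valued_vanishing m f : vanishing G m f -> central_valued G m f.
Proof. by move=> vf u hu; rewrite vf // linear0 gsupp0. Qed.

Lemma central_valued_lie m : central_valued G m (fgen F 0 * fgen F 1 - fgen F 1 * fgen F 0).
Proof.
move=> u _; rewrite linearB /= !rmorphM /= !substX commutator_value //.
rewrite raddfMn /= gpart_neq ?mul0rn ?gsupp0 //.
exact: (parityM (gpart_parity true (u 0%N)) (gpart_parity true (u 1%N))).
Qed.

Lemma central_valued_w m q n : central_valued G m (wprod (fgen F) q n).
Proof.
move=> u _; rewrite rmorph_wprod.
have -> : subst u \o fgen F = u \o id by apply/funext => i; rewrite /= substX.
rewrite wprod_value // raddfMn /= gpart_neq ?mul0rn ?gsupp0 //.
apply: (@parityM _ _ false false); first exact: tprod_even.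
by apply: xprod_even; rewrite size_map size_iota odd_double.
Qed.

(** With (m + 1)/2 factors the odd part is a differential d(t^s) of weight m, just enough for
    centrality. *)
Lemma central_valued_circ m : odd m -> central_valued G m (circp (fgen F) (m.+1)./2).
Proof.
move=> om u hu.
have [n En] : exists n, (m.+1)./2 = n.+1 by exists ((m.+1)./2.-1); lia.
rewrite En circp_jprod // linearZ linearZ /=; apply: gsuppZ.
have -> : jprod (rev (mkseq (fgen F) n.+1)) = jmonomial (fgen F) (rev (iota 0 n.+1)) [::].
  by rewrite /jmonomial cats0 map_rev.
rewrite gpart_fmon // /xprod big_nil mulr1.
have := dtprod_card hu (rev (iota 0 n.+1)); rewrite size_rev size_iota.
by rewrite (_ : n.+1.*2.-1 = m) //; lia.
Qed.

Lemma var0_central m : (m <= 1)%N -> central_valued G m (fgen F 0).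
Proof.
move=> m1 u hu; rewrite substX; apply: gsuppW (ovar_card hu 0%N) => A.
exact: leq_trans.
Qed.

Lemma var0_not_vanishing m : (0 < m)%N -> ~ vanishing G m (fgen F 0).
Proof.
move=> m0; pose u := fun i : nat => if i == 0%N then gbas G [fset 0%N]%fset else 0.
have hu : admissible m u.
  by move=> i; rewrite /u; case: ifP => _; [exact: gbas1_g0_supp|exact: gsupp0].
move=> /(_ _ hu); rewrite substX /u eqxx.
move/(congr1 (gcoef G [fset 0%N]%fset)); rewrite gcoef_bas eqxx linear0.
by move/eqP; rewrite oner_eq0.
Qed.

Lemma lie_not_vanishing m : (1 < m)%N ->
  ~ vanishing G m (fgen F 0 * fgen F 1 - fgen F 1 * fgen F 0).
Proof.
move=> m1; pose u := fun i : nat => if (i < 2)%N then gbas G [fset i]%fset else 0.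
have hu : admissible m u.
  move=> i; rewrite /u; case: ifP => i2; last exact: gsupp0.
  by apply: gbas1_g0_supp; apply: leq_trans i2 _.
move=> /(_ _ hu); rewrite linearB /= !rmorphM /= !substX commutator_value //.
have o i : (i < 2)%N -> ovar u i = gbas G [fset i]%fset.
  by move=> i2; rewrite /ovar /u i2 gpart_id //; apply: gbas1_odd.
rewrite !o // => /(congr1 (gcoef G (initial 2))).
rewrite raddfMn /= gcoef_initialS -[gbas G _]mul1r gcoef_initialS -(gbas1 G).
rewrite gcoef_bas linear0 (_ : fset0 == initial 0) => [/eqP|]; last first.
  by apply/eqP/fsetP => i; rewrite initialE in_fset0.
by rewrite (negPf two_neq0).
Qed.

Lemma substX_lie (A : algType k) (v : nat -> A) :
  subst v (fgen F 0 * fgen F 1 - fgen F 1 * fgen F 0) = v 0%N * v 1%N - v 1%N * v 0%N.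
Proof. by rewrite linearB /= !rmorphM /= !substX. Qed.

Lemma substX_wprod (A : algType k) (v : nat -> A) q n :
  subst v (wprod (fgen F) q n) = wprod v q n.
Proof. by rewrite rmorph_wprod; congr wprod; apply/funext => i; rewrite /= substX. Qed.

Lemma substX_circp (A : algType k) (v : nat -> A) n :
  subst v (circp (fgen F) n) = circp v n.
Proof. by rewrite rmorph_circp; congr circp; apply/funext => i; rewrite /= substX. Qed.

End ModelCentral.

(** * Homomorphisms and T-spaces *)

Section Homomorphisms.
Variables (k : fieldType) (B : nuAlgType k) (A : algType k).
(** Used for [fval] and for [gval], so that endomorphisms of the free algebra and homomorphisms to
    the Grassmann algebra are handled at once. *)
Variable iota : {linear B -> A}.
Hypothesis iota_inj : injective iota.
Hypothesis iotaM : forall x y, iota (x ** y) = iota x * iota y.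

Definition fval (f : free0 k) : freeM k := val f.

Lemma fval_linear : linear fval. Proof. by []. Qed.
HB.instance Definition _ := GRing.isLinear.Build k (free0 k) (freeM k) *:%R
  fval fval_linear.

Lemma fvalL a f g : fval (a *: f + g) = a *: fval f + fval g.
Proof. exact: fval_linear. Qed.

Lemma fconst_fval (f : free0 k) : fconst (fval f) = 0.
Proof. exact/eqP/(valP f). Qed.

Lemma fvalM (f g : free0 k) : fval (f ** g) = fval f * fval g. Proof. by []. Qed.

Lemma fval_var i : fval (var k i) = fgen (freeM k) i. Proof. by []. Qed.

Lemma fval_inj : injective fval. Proof. exact: val_inj. Qed.

Lemma fpart_subproof (f : freeM k) : (f - fconst f *: 1 : freeM k) \in @free0_pred k.
Proof.
have : fconst (f - fconst f *: 1) = 0 by rewrite linearB linearZ /= rmorph1 mulr1 subrr.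
by move=> h; rewrite unfold_in; apply/eqP.
Qed.
Definition fpart (f : freeM k) : free0 k := Free0 (fpart_subproof f).

Lemma fval_fpart f : fval (fpart f) = f - fconst f *: 1. Proof. by []. Qed.

Lemma fpartK f : fconst f = 0 -> fval (fpart f) = f.
Proof. by move=> f0; rewrite fval_fpart f0 scale0r subr0. Qed.

Lemma fval_nu_circ (f g : free0 k) :
  fval (nu_circ f g) = fval f * fval g + fval g * fval f.
Proof. by []. Qed.

Lemma fpart_fval f : fpart (fval f) = f.
Proof. by apply: fval_inj; rewrite fval_fpart fconst_fval scale0r subr0. Qed.

Lemma hom_subst (phi : {linear free0 k -> B}) : nu_morphism phi ->
  forall f, iota (phi f) = subst (fun i => iota (phi (var k i))) (fval f).
Proof.
move=> phiM f; set u := fun i => _.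
(* [phi] is defined only without constant terms, while words are built up from 1; the constant is
   split off and put back. *)
suff h (g : freeM k) : iota (phi (fpart g)) + fconst g *: 1 = subst u g.
  by rewrite -{1}(fpart_fval f) -h fconst_fval scale0r addr0.
elim/free_ind: g => [|a g h IHg IHh||i g IHg].
- rewrite !linear0 scale0r addr0 (_ : fpart 0 = 0) ?linear0 //.
  by apply: fval_inj; rewrite fval_fpart !linear0 scale0r subr0.
- have -> : fpart (a *: g + h) = a *: fpart g + fpart h.
    apply: fval_inj; rewrite linearP /= !fval_fpart linearP /= scalerDl -scalerA.
    by rewrite scalerBr opprD addrACA.
  by rewrite !linearP /= scalerDl -scalerA addrACA -scalerDr IHg IHh.
- rewrite !rmorph1 scale1r (_ : fpart 1 = 0) ?linear0 ?add0r //.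
  by apply: fval_inj; rewrite fval_fpart rmorph1 scale1r subrr.
have -> : fpart (fgen (freeM k) i * g) = var k i ** fpart g + fconst g *: var k i.
  apply: fval_inj; rewrite linearD linearZ /= fvalM !fval_fpart fval_var.
  by rewrite rmorphM /= fconstX mul0r scale0r subr0 mulrBr -scalerAr mulr1 subrK.
rewrite linearD phiM linearD iotaM !linearZ /= !rmorphM /= fconstX mul0r scale0r addr0.
by rewrite substX -IHg mulrDr -scalerAr mulr1.
Qed.

(** Removing the constant term keeps values in the image of [iota]; injectivity then makes the
    chosen preimages depend linearly and multiplicatively on f. *)
Lemma subst_hom (u : nat -> B) : exists phi : {linear free0 k -> B},
  nu_morphism phi /\ forall f, iota (phi f) = subst (iota \o u) (fval f).
Proof.
have ex f : exists b, iota b = subst (iota \o u) (fval f).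
  suff h (g : freeM k) : exists b, iota b = subst (iota \o u) g - fconst g *: 1.
    by have [b Eb] := h (fval f); exists b; rewrite Eb fconst_fval scale0r subr0.
  elim/free_ind: g => [|a g h [b Eb] [c Ec]||i g [b Eb]].
  - by exists 0; rewrite !linear0 scale0r subr0.
  - exists (a *: b + c); rewrite !linearP /= Eb Ec scalerDl -scalerA scalerBr.
    by rewrite opprD addrACA.
  - by exists 0; rewrite linear0 !rmorph1 scale1r subrr.
  exists (u i ** b + fconst g *: u i).
  rewrite linearD linearZ /= iotaM Eb !rmorphM /= fconstX mul0r scale0r subr0 substX.
  by rewrite mulrBr -scalerAr mulr1 subrK.
pose phi f : B := sval (cid (ex f)).
have phiE f : iota (phi f) = subst (iota \o u) (fval f) by exact: svalP (cid (ex f)).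
have phiL : linear phi.
  by move=> a f g; apply: iota_inj; rewrite [RHS]linearP /= !phiE -linearP.
pose phiLM := GRing.isLinear.Build k (free0 k) B *:%R phi phiL.
pose Phi : {linear free0 k -> B} := HB.pack phi phiLM.
exists Phi; split; last exact: phiE.
by move=> f g; apply: iota_inj; rewrite iotaM !phiE fvalM rmorphM.
Qed.

End Homomorphisms.

Section Tspaces.
Variable k : fieldType.
Implicit Types (V W : set (free0 k)) (f g : free0 k).

Lemma Tspan_sub V : V `<=` Tspan V.
Proof. exact: sub_gen_smallest. Qed.

Lemma Tspan_min V W : is_Tspace W -> V `<=` W -> Tspan V `<=` W.
Proof. exact: smallest_sub. Qed.

Lemma Tspan_Tspace V : is_Tspace (Tspan V).
Proof.
split; first split.
- by move=> W [[[W0 _] _] _].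
- move=> a f g hf hg W hW; have [[[_ WL] _] _] := hW; apply: WL; [exact: hf|exact: hg].
by move=> phi phiM f hf W hW; have [[_ WT] _] := hW; apply: WT => //; exact: hf.
Qed.

Lemma add_sets_Tspace V W : is_Tspace V -> is_Tspace W -> is_Tspace (add_sets V W).
Proof.
move=> [[V0 VL] VT] [[W0 WL] WT]; split; first split.
- by exists 0 => //; exists 0 => //; rewrite addr0.
- move=> a _ _ [v Vv [w Ww <-]] [v' Vv' [w' Ww' <-]].
  exists (a *: v + v'); first exact: VL.
  by exists (a *: w + w'); [exact: WL|rewrite scalerDr addrACA].
move=> phi phiM _ [v Vv [w Ww <-]].
by exists (phi v); [exact: VT|exists (phi w); [exact: WT|rewrite linearD]].
Qed.

Lemma add_sets_subl V W : is_Tspace W -> V `<=` add_sets V W.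
Proof. by move=> [[W0 _] _] v Vv; exists v => //; exists 0 => //; rewrite addr0. Qed.

Lemma add_sets_subr V W : is_Tspace V -> W `<=` add_sets V W.
Proof. by move=> [[V0 _] _] w Ww; exists 0 => //; exists w => //; rewrite add0r. Qed.

Lemma add_sets_min V W Z : is_Tspace Z -> V `<=` Z -> W `<=` Z -> add_sets V W `<=` Z.
Proof.
move=> [[_ ZL] _] VZ WZ _ [v Vv [w Ww <-]]; rewrite -[v]scale1r.
by apply: ZL; [exact: VZ|exact: WZ].
Qed.

Lemma Tspace_subst V (u : nat -> free0 k) f : is_Tspace V -> V f ->
  exists2 g, V g & fval g = subst (fun i => fval (u i)) (fval f).
Proof.
move=> [_ VT] Vf; have [phi [phiM phiE]] := subst_hom (@fval_inj k) (@fvalM k) u.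
by exists (phi f); [exact: VT|rewrite phiE].
Qed.

End Tspaces.

(** * Transfer to the concrete algebras and conclusion *)

Section Subalgebra.
Variable k : fieldType.
Local Notation G := (grassmannM k).

Definition gval (b : grassmann0 k) : G := val b.

Fact gval_linear : linear gval. Proof. by []. Qed.
HB.instance Definition _ := GRing.isLinear.Build k (grassmann0 k) G *:%R
  gval gval_linear.

Lemma gvalM (x y : grassmann0 k) : gval (x ** y) = gval x * gval y.
Proof. by []. Qed.

Lemma gval_inj : injective gval. Proof. exact: val_inj. Qed.

Lemma grassmann0_fin_supp m b : grassmann0_fin m b <-> gsupp (g0_supp m) (gval b).
Proof.
split.
  move: b; apply: smallest_sub; last first.
    by move=> _ [i im <-]; apply: (gbas1_g0_supp G im).
  split; first split.
  - exact: gsupp0.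
  - by move=> a x y hx hy; apply: (gsuppL a hx hy).
  by move=> x y hx hy; apply: (g0_suppM hx hy).
move=> hb C [[[C0 CL] CM] Cgen].
suff [b' Eb' Cb'] : exists2 b', gval b' = gval b & C b' by rewrite -(gval_inj Eb').
move: hb; apply: (@g0_supp_ind _ G m (fun v => exists2 b', gval b' = v & C b')).
- by exists 0.
- by move=> a _ _ [x <- Cx] [y <- Cy]; exists (a *: x + y) => //; apply: CL.
- by move=> _ _ [x <- Cx] [y <- Cy]; exists (x ** y) => //; apply: CM.
by move=> i im; exists (gen k i) => //; apply: Cgen; exists i.
Qed.

Lemma hom_fin_admissible m phi : hom_fin m phi ->
  @admissible k G m (fun i => gval (phi (var k i))).
Proof. by move=> [_ h] i; apply/grassmann0_fin_supp. Qed.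

Lemma hom_fin_subst m phi f : hom_fin m phi ->
  gval (phi f) = subst (fun i => gval (phi (var k i))) (fval f).
Proof. by move=> [phiM _]; exact: (hom_subst gvalM phiM). Qed.

Lemma admissible_hom m (u : nat -> G) : @admissible k G m u ->
  exists phi, hom_fin m phi /\ forall f, gval (phi f) = subst u (fval f).
Proof.
move=> hu.
have lift i : exists b, gval b = u i.
  have u0 : (u i : grassmann k) \in @grassmann0_pred k.
    rewrite unfold_in; apply/negPn/negP => h.
    by have /gsuppP/(_ fset0 h) := hu i; rewrite /g0_supp eqxx.
  by exists (Grassmann0 u0).
have [b bE] := choice lift.
have [phi [phiM phiE]] := subst_hom gval_inj gvalM b.
have E : gval \o b = u by apply/funext => i /=.
exists phi; split; last by move=> f; rewrite phiE E.
split=> // f; apply/grassmann0_fin_supp; rewrite phiE E.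
by apply: subst_g0_supp hu _; apply: fconst_fval.
Qed.

Lemma T_idealE m f : T_ideal m f <-> vanishing G m (fval f).
Proof.
split=> [Tf u hu|vf phi hphi].
  have [phi [hphi phiE]] := admissible_hom hu.
  by rewrite -phiE (Tf _ hphi) linear0.
apply: gval_inj; rewrite (hom_fin_subst _ hphi) linear0; apply: vf.
exact: hom_fin_admissible.
Qed.

Hypothesis two_neq0 : 2%:R != 0 :> k.

Lemma centerP m b : grassmann0_fin m b ->
  nu_center (grassmann0_fin m) b <-> gsupp (card_ge m) (gpart true (gval b)).
Proof.
move=> bm; have hb := (grassmann0_fin_supp m b).1 bm.
apply: iff_trans (g0_centerP two_neq0 hb); split=> [[_ bC] x hx|zC].
  have x0 : (x : grassmann k) \in @grassmann0_pred k.
    rewrite unfold_in; apply/negPn/negP => h.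
    by have /gsuppP/(_ fset0 h) := hx; rewrite /g0_supp eqxx.
  pose x' := Grassmann0 x0.
  have x'm : grassmann0_fin m x' by apply/grassmann0_fin_supp.
  exact: (congr1 gval (bC _ x'm)).
split=> // x /grassmann0_fin_supp hx; apply: gval_inj; exact: zC hx.
Qed.

(** Unlike [central_polynomial], this retains the identities, which makes it a T-space. *)
Definition central_set m : set (free0 k) :=
  [set f | forall phi : {linear free0 k -> grassmann0 k},
     hom_fin m phi -> nu_center (grassmann0_fin m) (phi f)].

Lemma central_setE m f : central_set m f <-> central_valued G m (fval f).
Proof.
split=> [Cf u hu|Cf phi hphi].
  have [phi [hphi phiE]] := admissible_hom hu; rewrite -phiE.
  by apply/centerP; [exact: hphi.2|exact: Cf].
apply/centerP; first exact: hphi.2.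
by rewrite (hom_fin_subst _ hphi); apply: Cf; apply: hom_fin_admissible.
Qed.

Lemma hom_fin_comp m (phi : {linear free0 k -> grassmann0 k})
    (psi : {linear free0 k -> free0 k}) :
  hom_fin m phi -> nu_morphism psi -> hom_fin m (phi \o psi : {linear _ -> _}).
Proof.
by move=> [phiM hphi] psiM; split=> [f g|f] /=; [rewrite psiM phiM|exact: hphi].
Qed.

Lemma T_ideal_Tspace m : is_Tspace (@T_ideal k m).
Proof.
split; first split.
- by move=> phi _; rewrite linear0.
- by move=> a f g hf hg phi hphi; rewrite linearP /= hf // hg // scaler0 addr0.
by move=> psi psiM f hf phi hphi; apply: (hf _ (hom_fin_comp hphi psiM)).
Qed.

Lemma central_set_Tspace m : is_Tspace (central_set m).
Proof.
split; first split.
- by apply/central_setE => u _; rewrite !linear0 gsupp0.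
- move=> a f g /central_setE hf /central_setE hg; apply/central_setE.
  by rewrite fvalL; apply: central_valuedL.
by move=> psi psiM f hf phi hphi; apply: (hf _ (hom_fin_comp hphi psiM)).
Qed.

Lemma T_ideal_central m : @T_ideal k m `<=` central_set m.
Proof.
by move=> f /T_idealE vf; apply/central_setE; apply: central_valued_vanishing.
Qed.

Lemma fval_circ n : fval (circ_prod k n) = circp (fgen (freeM k)) n.
Proof.
case: n => [|n]; first exact: linear0.
elim: n => [|n IH].
  exact: fval_var.
have -> : circ_prod k n.+2 = nu_circ (circ_prod k n.+1) (var k n.+1) by [].
by rewrite fval_nu_circ IH fval_var.
Qed.

Lemma fval_w p n : fval (w k p n) = wprod (fgen (freeM k)) (p - 1) n.+1.
Proof. by []. Qed.

Lemma fval_lie01 :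
  fval (lie01 k) = fgen (freeM k) 0 * fgen (freeM k) 1 - fgen (freeM k) 1 * fgen (freeM k) 0.
Proof. by []. Qed.

Lemma lie01_central m : central_set m (lie01 k).
Proof. by apply/central_setE; rewrite fval_lie01; apply: central_valued_lie. Qed.

Lemma w_central p m n : central_set m (w k p n).
Proof. by apply/central_setE; rewrite fval_w; apply: central_valued_w. Qed.

Lemma circ_central m : odd m -> central_set m (circ_prod k (m.+1 %/ 2)).
Proof.
by move=> om; apply/central_setE; rewrite fval_circ divn2; apply: central_valued_circ.
Qed.

Lemma S_space_Tspace p : is_Tspace (@S_space k p).
Proof.
by rewrite /S_space; case: ifP => _; [|apply: add_sets_Tspace]; apply: Tspan_Tspace.
Qed.

Lemma Sm_space_Tspace p m : is_Tspace (@Sm_space k p m).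
Proof.
rewrite /Sm_space; case: ifP => _; last exact: S_space_Tspace.
by apply: add_sets_Tspace; [exact: S_space_Tspace|exact: Tspan_Tspace].
Qed.

Lemma U_space_Tspace p m : is_Tspace (U_space k p m).
Proof. by apply: add_sets_Tspace; [exact: Sm_space_Tspace|exact: T_ideal_Tspace]. Qed.

Lemma U_space_central p m : U_space k p m `<=` central_set m.
Proof.
have CT := central_set_Tspace m.
have CS : @S_space k p `<=` central_set m.
  have Cl : Tspan [set lie01 k] `<=` central_set m.
    by apply: (Tspan_min CT) => _ ->; apply: lie01_central.
  rewrite /S_space; case: ifP => // _; apply: (add_sets_min CT Cl).
  by apply: (Tspan_min CT) => _ [n _ <-]; apply: w_central.
apply: (fun H => add_sets_min CT H (@T_ideal_central m)).
rewrite /Sm_space; case: ifP => // om; apply: (add_sets_min CT CS).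
by apply: (Tspan_min CT) => _ ->; apply: circ_central.
Qed.

Lemma S_sub_U p m : @S_space k p `<=` U_space k p m.
Proof.
move=> f Sf; apply: (add_sets_subl (T_ideal_Tspace m)).
rewrite /Sm_space; case: ifP => // _.
exact: (add_sets_subl (@Tspan_Tspace _ _)).
Qed.

Lemma central_sub_U p m : has_characteristic k p ->
  central_set m `<=` U_space k p m.
Proof.
move=> char_k f /central_setE Cf.
have [[U0 UL] UT] := U_space_Tspace p m.
pose U g := exists2 h, U_space k p m h & fval h = g.
have Usubst (v : nat -> freeM k) h : (forall i, fconst (v i) = 0) ->
    U_space k p m h -> U (subst v (fval h)).
  move=> v0 Uh; have [g Ug gE] := Tspace_subst (fun i => fpart (v i)) (U_space_Tspace p m) Uh.
  have E : (fun i => fval (fpart (v i))) = v by apply/funext => i; apply: fpartK.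
  by rewrite E in gE; exists g.
have [] := @all_good k (grassmannM k) p m two_neq0 char_k (freeM k) U _ _ _ _ _
  (fval f) (fconst_fval f).
- move=> a _ _ [g Ug <-] [h Uh <-]; exists (a *: g + h); [exact: UL|exact: fvalL].
- move=> g vg; have g0 := vanishing_fconst vg; exists (fpart g).
    apply: (add_sets_subr (Sm_space_Tspace p m)); apply/T_idealE.
    by rewrite fpartK.
  exact: fpartK.
- move=> g h g0 h0; pose v i := if i == 0%N then g else h.
  have -> : g * h - h * g = subst v (fval (lie01 k)) by rewrite fval_lie01 substX_lie.
  apply: Usubst => [i|]; first by rewrite /v; case: ifP.
  apply: S_sub_U; rewrite /S_space; case: ifP => _; first exact: Tspan_sub.
  apply: (add_sets_subl (@Tspan_Tspace _ _)); exact: Tspan_sub.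
- move=> p0 a n.
  have -> : wprod (fun i => fgen (freeM k) (a i)) p.-1 n.+1 =
      subst (fun i => fgen (freeM k) (a i)) (fval (w k p n)).
    by rewrite fval_w subn1 substX_wprod.
  apply: Usubst => [i|]; first exact: fconstX.
  apply: S_sub_U; rewrite /S_space (negPf p0); apply: (add_sets_subr (@Tspan_Tspace _ _)).
  by apply: Tspan_sub; exists n.
- move=> om x x0.
  have -> : circp x (m.+1)./2 = subst x (fval (circ_prod k (m.+1 %/ 2))).
    by rewrite fval_circ divn2 substX_circp.
  apply: Usubst => //; apply: (add_sets_subl (T_ideal_Tspace m)).
  rewrite /Sm_space om; apply: (add_sets_subr (S_space_Tspace p)); exact: Tspan_sub.
move=> l nl [g Ug gE].
have c0 : comb (freeM k) l = 0.
  (* The combination is the difference of f and an element of [U_space], both with central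
     values. *)
  apply: (comb_eq0 two_neq0 char_k nl).
  apply: (central_valued_diff Cf _ gE).
  exact/central_setE/(U_space_central Ug).
by move: gE; rewrite c0 subr0 => /fval_inj <-.
Qed.

(** For m = 1 all products vanish, so the commutator is an identity and a single variable is used;
    for larger m the commutator works. *)
Lemma central_polynomial_ex m : (0 < m)%N -> exists f : free0 k, central_polynomial m f.
Proof.
move=> m0; have [m1|m1] := leqP m 1.
  exists (var k 0); split.
    by move/T_idealE; rewrite fval_var; apply: var0_not_vanishing.
  by apply/central_setE; rewrite fval_var; apply: var0_central.
exists (lie01 k); split; last exact: lie01_central.
by move/T_idealE; rewrite fval_lie01; apply: lie_not_vanishing.
Qed.

(** An identity f is recovered as (g + f) - g, where g is any central polynomial: both terms are
    central and neither is an identity. *)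
Lemma CP_central_set m : (0 < m)%N -> CP k m = central_set m.
Proof.
move=> m0; apply/seteqP; split.
  by apply: Tspan_min (central_set_Tspace m) _ => f [].
have [g cg] := central_polynomial_ex m0.
have [[_ CPL] _] := Tspan_Tspace (@central_polynomial k m).
move=> f cf; have [Tf|nTf] := pselect (T_ideal m f); last exact: Tspan_sub.
have gCP : CP k m g by exact: Tspan_sub.
rewrite -(addKr g f) -scaleN1r; apply: CPL => //; apply: Tspan_sub; split.
  move=> Tgf; apply: (cg.1); have [[_ TL] _] := T_ideal_Tspace m.
  by rewrite -(addrK f g) addrC -scaleN1r; apply: TL.
have [[_ CL] _] := central_set_Tspace m.
by rewrite -[g]scale1r; apply: CL => //; exact: cg.2.
Qed.

End Subalgebra.

Close Scope ring_scope.
Close Scope classical_set_scope.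
Close Scope fset_scope.

Theorem theorem3p1 (k : fieldType) (p : nat)
  (char_k : has_characteristic k p) (p_neq2 : p <> 2)
  (m : nat) (m_gt0 : 0 < m) :
  CP k m = U_space k p m.
Proof.
have two_neq0 : (2%:R != 0 :> k)%R.
  move: char_k; rewrite /has_characteristic.
  case: eqP => [_ /pcharf0P -> //|_ pk].
  rewrite -(dvdn_pcharf pk) dvdn_prime2 ?(pcharf_prime pk) //.
  exact/eqP.
rewrite CP_central_set //; apply/seteqP; split; first exact: central_sub_U.
exact: U_space_central.
Qed.
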